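(* Let $(M,L)$ and $(M,\widetilde L)$ be conformally related Finsler manifolds with $\widetilde g=e^{2\sigma(x)}g$. The associated Chern connections $D^{c}$ and $\widetilde{D^{c}}$ are related by $$\widetilde{D^{c}}_{X}\overline{Y}=D^{c}_{X}\overline{Y}+\omega^{c}(X,\overline{Y})$$ for all vector fields $X$ on $\mathcal{T}M$ and all $\pi$-vector fields $\overline Y$, where $$\omega^{c}(X,\overline{Y}):=(hX\cdot\sigma)\,\overline{Y}+(\beta\overline{Y}\cdot\sigma)\,\rho X-g(\rho X,\overline{Y})\,\overline{P}-T(N\overline{Y},\rho X)+T'(\mathcal{L}X,\beta\overline{Y})-T(N\rho X,\overline{Y}).$$ In particular, for all $\pi$-vector fields $\overline X,\overline Y$: (a) $\widetilde{D^{c}}_{\gamma\overline{X}}\overline{Y}=D^{c}_{\gamma\overline{X}}\overline{Y}$; (b) $\widetilde{D^{c}}_{\widetilde{\beta}\overline{X}}\overline{Y}=D^{c}_{\beta\overline{X}}\overline{Y}-D^{c}_{\gamma N\overline{X}}\overline{Y}+B^{c}(\overline{X},\overline{Y})$, where $B^{c}(\overline{X},\overline{Y}):=\omega^{c}(\beta\overline{X},\overline{Y})$.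
   Context: $M$ is a real paracompact $C^\infty$ manifold of finite dimension $n$; all objects are $C^\infty$. $\pi:\mathcal{T}M\to M$ is the bundle of nonzero tangent vectors, $\pi^{-1}(TM)$ the pullback of $TM$ by $\pi$ (a vector bundle over $\mathcal{T}M$). Sections of $\pi^{-1}(TM)$ are called $\pi$-vector fields and written $\overline X,\overline Y,\dots$; $\overline\eta$ is the $\pi$-vector field $\overline\eta(u)=(u,u)$. $\rho:T(\mathcal{T}M)\to\pi^{-1}(TM)$ is $\rho=(\pi_{\mathcal{T}M},d\pi)$ and $\gamma:\pi^{-1}(TM)\to T(\mathcal{T}M)$ is the vertical lift, $\gamma(u,v)=j_u(v)$ with $j_u:T_{\pi(u)}M\to T_u(T_{\pi(u)}M)$ the natural isomorphism. For a linear connection $D$ on $\pi^{-1}(TM)$, $K(X):=D_X\overline\eta$; $D$ is regular if $T(\mathcal{T}M)=V(\mathcal{T}M)\oplus H(\mathcal{T}M)$ with $H=\ker K$ and $V$ the vertical bundle, and then $\beta:=(\rho|_{H})^{-1}$ and $h:=\beta\circ\rho$ is the horizontal projector. The torsion is $\mathbf{T}(X,Y)=D_X\rho Y-D_Y\rho X-\rho[X,Y]$, with $Q(\overline X,\overline Y)=\mathbf{T}(\beta\overline X,\beta\overline Y)$ and (h)hv-torsion $T(\overline X,\overline Y)=\mathbf{T}(\gamma\overline X,\beta\overline Y)$. $(M,L)$ is a Finsler manifold and $g$ the Finsler metric on $\pi^{-1}(TM)$ defined by $L$ (vertical Hessian of $\frac12L^2$). The Cartan connection $\nabla$ is the unique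 regular connection on $\pi^{-1}(TM)$ with $\nabla g=0$, $Q=0$ and $g(T(\overline X,\overline Y),\overline Z)=g(T(\overline X,\overline Z),\overline Y)$; $T$, $K$, $\beta$, $h$ below are those of $\nabla$. The Chern (Rund) connection is $D^{c}_X\overline Y=\nabla_X\overline Y-T(KX,\overline Y)$; it has the same $\beta$, $K$, $h$. $(M,L)$ and $(M,\widetilde L)$ are conformally related if $\widetilde g=e^{2\sigma(x)}g$ (equivalently $\widetilde L^2=e^{2\sigma(x)}L^2$) for a positive differentiable function $\sigma$ on $M$ (viewed also as a function on $\mathcal{T}M$). Objects of $(M,\widetilde L)$ carry a tilde. $N$ is the $\pi$-tensor field $N(\overline X):=\widetilde\nabla_{\beta\overline X}\overline\eta-\nabla_{\beta\overline X}\overline\eta$, and $\mathcal{L}:=\gamma\circ N\circ\rho$; one has $\widetilde\beta=\beta-\mathcal{L}\circ\beta$. $\overline P$ is the $\pi$-vector field with $g(\overline P,\rho Z)=hZ\cdot\sigma$ for all $Z$. $T'(\mathcal{L}X,\beta\overline Y)$ denotes the $\pi$-vector field determined by $g(T'(\mathcal{L}X,\beta\overline Y),\overline Z)=g(T(N\overline Z,\overline Y),\rho X)$ for all $\overline Z$. *)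

(* Defs.v *)
From mathcomp Require Export all_boot all_order all_algebra.
From mathcomp Require Export all_classical all_reals all_analysis.
Export numFieldNormedType.Exports.
Set Implicit Arguments.
Unset Strict Implicit.
Unset Printing Implicit Defensive.
Import Order.TTheory GRing.Theory Num.Theory.
Local Open Scope classical_set_scope.
Local Open Scope ring_scope.

(* C^oo on A: all iterated directional derivatives are (Frechet) differentiable
   at the points of A.  Only used for open A. *)
Definition smooth_on (R : realType) (V W : normedModType R) (A : set V)
    (f : V -> W) : Prop :=
  forall (vs : seq V) (x : V), A x ->
    differentiable (foldr (fun v h => (fun y => 'D_v h y)) f vs) x.

(* A chart is a map to R^n given together with a total function that extends
   the inverse; both are only relevant on chart_dom and chart_cod. *)
Record chart (R : realType) (n : nat) (T : Type) := Chart {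
  chart_dom : set T;
  chart_map : T -> 'rV[R]_n;
  chart_inv : 'rV[R]_n -> T }.

Definition chart_cod (R : realType) (n : nat) (T : Type) (c : chart R n T) :
  set 'rV[R]_n := chart_map c @` chart_dom c.

Definition is_chart (R : realType) (n : nat) (T : topologicalType)
    (c : chart R n T) : Prop :=
  [/\ open (chart_dom c) /\ open (chart_cod c),
      forall x, chart_dom c x -> chart_inv c (chart_map c x) = x,
      {within chart_dom c, continuous (chart_map c)} &
      {within chart_cod c, continuous (chart_inv c)}].

Definition paracompact (T : topologicalType) : Prop :=
  forall U : set (set T),
    (forall A, U A -> open A) -> (forall x, exists2 A, U A & A x) ->
  exists V : set (set T),
    [/\ forall B, V B -> open B,
        forall x, exists2 B, V B & B x,
        forall B, V B -> exists2 A, U A & B `<=` A &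
        forall x : T, exists2 O, nbhs x O &
          finite_set [set B | V B /\ B `&` O !=set0]].

Record manifold (R : realType) (n : nat) := Manifold {
  carrier :> topologicalType;
  atlas : set (chart R n carrier);
  manifold_hausdorff : hausdorff_space carrier;
  manifold_paracompact : paracompact carrier;
  atlas_chart : forall c, atlas c -> is_chart c;
  atlas_cover : forall x, exists2 c, atlas c & chart_dom c x;
  atlas_smooth : forall c d, atlas c -> atlas d ->
    smooth_on (chart_map c @` (chart_dom c `&` chart_dom d))
              (chart_map d \o chart_inv c) }.

Section Tangent.
Context {R : realType} (S : Type).
Implicit Types (C : set (S -> R)) (p : S) (X Y : S -> (S -> R) -> R).

(* When C is the algebra of C^oo functions of a manifold S, this is the tangent
   space of S at p, as derivations of C at p.  Derivations are represented by
   operators on all functions, normalized to vanish outside C, so that equality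
   of derivations is equality of operators. *)
Definition tangent C p : set ((S -> R) -> R) :=
  [set v | [/\ forall f, ~ C f -> v f = 0,
      forall (a : R) f g, C f -> C g ->
        v (fun x => a * f x + g x) = a * v f + v g &
      forall f g, C f -> C g ->
        v (fun x => f x * g x) = f p * v g + g p * v f]].

Definition vector_field C X : Prop :=
  (forall p, tangent C p (X p)) /\
  (forall f, C f -> C (fun p => X p f)).

Definition lie_bracket X Y : S -> (S -> R) -> R := fun p f =>
  X p (fun q => Y q f) - Y p (fun q => X q f).

End Tangent.

Section Bundle.
Context {R : realType} {n : nat} (M : manifold R n).

Definition smoothM : set (M -> R) := [set f : M -> R |
  forall c, atlas c ->
  smooth_on (chart_cod c) (f \o chart_inv c)].

Notation vecM := ((M -> R) -> R).
Definition TM : Type := (M * vecM)%type.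

(* The inverse of the chart of TM induced by c: (a, b) is sent to the tangent
   vector with components b at the point with coordinates a. *)
Definition TM_chart_inv (c : chart R n M) (ab : 'rV[R]_n * 'rV[R]_n) : TM :=
  (chart_inv c ab.1,
   fun f => if `[< smoothM f >] then 'D_(ab.2) (f \o chart_inv c) ab.1 else 0).

Definition slit_set : set (M * vecM) :=
  [set u | tangent smoothM u.1 u.2 /\ u.2 <> 0].
Definition slit : Type := set_type slit_set.

Definition base (u : slit) : M := (val u).1.
Definition vec (u : slit) : vecM := (val u).2.

Definition extend0 (F : slit -> R) (u : TM) : R :=
  oapp F 0 (insub u : option (set_type slit_set)).

Definition smoothTM : set (slit -> R) := [set F : slit -> R |
  forall c, atlas c ->
  smooth_on [set ab | chart_cod c ab.1 /\ ab.2 <> 0]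
            (extend0 F \o TM_chart_inv c)].

Notation vecTM := ((slit -> R) -> R).

(* The fibre of pi^{-1}(TM) at u is the tangent space of M at base u.  A section
   of pi^{-1}(TM) is smooth iff it maps C^oo(M) to C^oo(slit). *)
Definition pi_field (Y : slit -> vecM) : Prop :=
  (forall u, tangent smoothM (base u) (Y u)) /\
  (forall f, smoothM f -> smoothTM (fun u => Y u f)).

Definition rho (u : slit) (w : vecTM) : vecM := fun f =>
  if `[< smoothM f >] then w (f \o base) else 0.

(* The velocity at t = 0 of the curve t |-> u + t x in the fibre through u. *)
Definition gamma (u : slit) (x : vecM) : vecTM := fun F =>
  if `[< smoothTM F >]
  then derive1 (fun t : R => extend0 F (base u, vec u + t *: x)) 0 else 0.

(* The vertical Hessian of L^2 / 2. *)
Definition finsler_metric (L : TM -> R) (u : slit) (x y : vecM) : R :=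
  derive1 (fun s : R => derive1 (fun t : R =>
    L (base u, vec u + s *: x + t *: y) ^+ 2 / 2) 0) 0.

Record finsler (L : TM -> R) : Prop := Finsler {
  finsler_continuous : forall c, atlas c -> forall ab : 'rV[R]_n * 'rV[R]_n,
    chart_cod c ab.1 -> {for ab, continuous (L \o TM_chart_inv c)};
  finsler_smooth : smoothTM (fun u => L (val u));
  finsler_homogeneous : forall (x : M) (v : vecM) (l : R),
    tangent smoothM x v -> 0 < l -> L (x, l *: v) = l * L (x, v);
  finsler_positive : forall u : slit, 0 < L (val u);
  finsler_definite : forall (u : slit) (x : vecM),
    tangent smoothM (base u) x -> x <> 0 -> 0 < finsler_metric L u x x }.

Definition conformal (L Lt : TM -> R) (sigma : M -> R) : Prop :=
  forall (u : slit) (x y : vecM),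
    tangent smoothM (base u) x -> tangent smoothM (base u) y ->
    finsler_metric Lt u x y =
      expR (2 * sigma (base u)) * finsler_metric L u x y.

(* Covariant derivatives on pi^{-1}(TM): D u w Y is the derivative at u of the
   section Y in the direction of the tangent vector w. *)
Definition covariant : Type := forall u : slit, vecTM -> (slit -> vecM) -> vecM.

Record linear_connection (D : covariant) : Prop := LinearConnection {
  connection_tangent : forall u w Y, tangent smoothTM u w -> pi_field Y ->
    tangent smoothM (base u) (D u w Y);
  connection_smooth : forall X Y, vector_field smoothTM X -> pi_field Y ->
    pi_field (fun u => D u (X u) Y);
  connection_linear : forall u (a : R) w1 w2 Y,
    tangent smoothTM u w1 -> tangent smoothTM u w2 -> pi_field Y ->
    D u (a *: w1 + w2) Y = a *: D u w1 Y + D u w2 Y;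
  connection_additive : forall u w Y Z,
    tangent smoothTM u w -> pi_field Y -> pi_field Z ->
    D u w (fun q => Y q + Z q) = D u w Y + D u w Z;
  connection_leibniz : forall u w F Y,
    tangent smoothTM u w -> smoothTM F -> pi_field Y ->
    D u w (fun q => F q *: Y q) = w F *: Y u + F u *: D u w Y }.

(* vec is the fundamental pi-vector field eta(u) = (u, u), so K(w) = D_w eta. *)
Definition Kmap (D : covariant) (u : slit) (w : vecTM) : vecM := D u w vec.

Definition vertical (u : slit) : set vecTM :=
  [set w | tangent smoothTM u w /\ rho u w = 0].
Definition horizontal (D : covariant) (u : slit) : set vecTM :=
  [set w | tangent smoothTM u w /\ Kmap D u w = 0].

Definition regular (D : covariant) : Prop := forall u : slit,
  (forall w, tangent smoothTM u w ->
     exists v h, [/\ vertical u v, horizontal D u h & w = v + h]) /\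
  vertical u `&` horizontal D u = [set 0].

Definition beta (D : covariant) (u : slit) (x : vecM) : vecTM :=
  xget 0 [set w | horizontal D u w /\ rho u w = x].
Definition hproj (D : covariant) (u : slit) (w : vecTM) : vecTM :=
  beta D u (rho u w).

Definition torsion (D : covariant) (X Y : slit -> vecTM) (u : slit) : vecM :=
  D u (X u) (fun q => rho q (Y q)) - D u (Y u) (fun q => rho q (X q))
  - rho u (lie_bracket X Y u).
Definition Qtorsion (D : covariant) (X Y : slit -> vecM) : slit -> vecM :=
  torsion D (fun q => beta D q (X q)) (fun q => beta D q (Y q)).
Definition hv_torsion (D : covariant) (X Y : slit -> vecM) : slit -> vecM :=
  torsion D (fun q => gamma q (X q)) (fun q => beta D q (Y q)).

Record cartan (L : TM -> R) (D : covariant) : Prop := Cartan {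
  cartan_linear : linear_connection D;
  cartan_regular : regular D;
  cartan_metric : forall u w Y Z,
    tangent smoothTM u w -> pi_field Y -> pi_field Z ->
    w (fun q => finsler_metric L q (Y q) (Z q)) =
      finsler_metric L u (D u w Y) (Z u) + finsler_metric L u (Y u) (D u w Z);
  cartan_Q : forall X Y, pi_field X -> pi_field Y ->
    forall u, Qtorsion D X Y u = 0;
  cartan_T : forall X Y Z, pi_field X -> pi_field Y -> pi_field Z ->
    forall u, finsler_metric L u (hv_torsion D X Y u) (Z u) =
              finsler_metric L u (hv_torsion D X Z u) (Y u) }.

(* The Chern connection attached to the Cartan connection D. *)
Definition chern (D : covariant) (X : slit -> vecTM) (Y : slit -> vecM)
    (u : slit) : vecM :=
  D u (X u) Y - hv_torsion D (fun q => Kmap D q (X q)) Y u.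

(* In the remaining definitions D and Dt are the Cartan connections of L and of
   the conformally related function. *)
Definition Nmap (D Dt : covariant) (u : slit) (x : vecM) : vecM :=
  Dt u (beta D u x) vec - D u (beta D u x) vec.

Definition Pbar (L : TM -> R) (sigma : M -> R) (D : covariant) (u : slit) :
    vecM :=
  xget 0 [set p | tangent smoothM (base u) p /\
    forall z, tangent smoothTM u z ->
      finsler_metric L u p (rho u z) = hproj D u z (sigma \o base)].

(* T'(gamma N rho X, beta Y). *)
Definition Tprime (L : TM -> R) (D Dt : covariant) (X : slit -> vecTM)
    (Y : slit -> vecM) (u : slit) : vecM :=
  xget 0 [set t | tangent smoothM (base u) t /\
    forall Z, pi_field Z ->
      finsler_metric L u t (Z u) =
      finsler_metric L u (hv_torsion D (fun q => Nmap D Dt q (Z q)) Y u)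
                         (rho u (X u))].

Definition omegac (L : TM -> R) (sigma : M -> R) (D Dt : covariant)
    (X : slit -> vecTM) (Y : slit -> vecM) (u : slit) : vecM :=
  hproj D u (X u) (sigma \o base) *: Y u
  + beta D u (Y u) (sigma \o base) *: rho u (X u)
  - finsler_metric L u (rho u (X u)) (Y u) *: Pbar L sigma D u
  - hv_torsion D (fun q => Nmap D Dt q (Y q)) (fun q => rho q (X q)) u
  + Tprime L D Dt X Y u
  - hv_torsion D (fun q => Nmap D Dt q (rho q (X q))) Y u.

Definition Bc (L : TM -> R) (sigma : M -> R) (D Dt : covariant)
    (X Y : slit -> vecM) : slit -> vecM :=
  omegac L sigma D Dt (fun q => beta D q (X q)) Y.

End Bundle.

Arguments TM_chart_inv {R n M}.
Arguments base {R n M}.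
Arguments vec {R n M}.
Arguments smoothTM {R n M}.
Arguments smoothM {R n M}.

(* Main.v *)
(** Write A(X,Y) for the difference of the two Chern derivatives of Y in the
    direction of the horizontal lift of X.  Both Chern connections differentiate
    in vertical directions by the flat connection of the fibres: K is a left
    inverse of the vertical lift, because T(X,eta) is a third fibre derivative of
    L^2/2 contracted with eta, which vanishes by homogeneity.  Hence the
    difference of the Chern connections in the direction of X only depends on
    rho X and equals A(rho X,Y).  By Q = 0 the form A is symmetric, and the two
    metric conditions together with beta~ = beta - gamma N give
    g(A(X,Y),Z) + g(Y,A(X,Z)) = 2 (X.sigma) g(Y,Z) - 2 g(T(NX,Y),Z).
    Koszul's trick solves these equations for A, and the solution is omega^c.

    Tangent vectors being derivations, these computations need the fact that
    every derivation of the smooth functions of a manifold is a directional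
    derivative in a chart, that is, Hadamard's lemma and smooth cutoff
    functions. *)
From HB Require Import structures.
From mathcomp Require Import ring lra.
Require Import Defs.
Set Implicit Arguments.
Unset Strict Implicit.
Unset Printing Implicit Defensive.
Import Order.TTheory GRing.Theory Num.Theory.
Local Open Scope classical_set_scope.
Local Open Scope ring_scope.

(** * Smooth functions on open sets *)

(** The obstacle is analytic. Smoothness is stated for total functions through iterated directional
    derivatives on an open set, so it is not established one derivative at a time: each closure
    property comes from a family of functions stable under all directional derivatives. Hadamard's
    lemma with smooth factors then needs differentiation under an integral sign, which follows from
    a Taylor bound uniform in the parameter. On the geometric side the torsion is defined by a
    bracket of fields, but it is applied to fields such as $N\overline Y$ and $KX$. Evaluating the
    bracket on functions pulled back from $M$ turns $T(\overline X,\overline Y)$ into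
    $D_{\gamma\overline X}\overline Y$ minus the fibre derivative of $\overline Y$, an expression
    that depends on $\overline X$ only through its value at the point. All later computations are
    pointwise in this sense. $\overline P$ and $T'$ are picked by a choice operator with a default
    value; they have their defining properties because the definite metric represents every linear
    form on a fibre. *)

Section SmoothOn.
Context {R : realType}.

Lemma near_eq_differentiable (V W : normedModType R) (f g : V -> W) (x : V) :
  (\near x, f x = g x) -> differentiable f x -> differentiable g x.
Proof.
move=> fg df.
have fgx : f x = g x by exact: nbhs_singleton fg.
apply/diff_locallyP.
have H : g \o shift x = cst (g x) + 'd f x +o_ 0 id.
  apply/eqaddoP => e e0.
  have /eqaddoP/(_ e e0) := diff_locally df; rewrite -fgx.
  apply: filter_app; apply/nbhs_ballP; have /nbhs_ballP [r r0 rfg] := fg.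
  exists r => // y yr /=; rewrite !fctE /= -rfg //.
  by move: yr; rewrite -!ball_normE /= sub0r opprD addrCA subrr addr0.
have dfc : continuous ('d f x) by exact: diff_continuous.
by rewrite (diff_unique dfc H).
Qed.

(** The basic tool for smoothness: by induction on the list of directions, every iterated derivative
    of a member of [F] agrees on [A] with a member of [F]. Agreement is asked on [A] only, since the
    values elsewhere are arbitrary; openness of [A] lets it pass to derivatives. *)
Lemma smooth_onP (V W : normedModType R) (A : set V) (F : set (V -> W)) :
  open A ->
  (forall f x, F f -> A x -> differentiable f x) ->
  (forall f v, F f -> exists2 g, F g & forall x, A x -> 'D_v f x = g x) ->
  forall f, F f -> smooth_on A f.
Proof.
move=> oA dF DF f Ff vs.
suff [g Fg fg] : exists2 g, F g &
    forall x, A x -> foldr (fun v h => (fun y => 'D_v h y)) f vs x = g x.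
  move=> x Ax; apply: near_eq_differentiable (dF _ _ Fg Ax).
  near=> y; apply/esym/fg; near: y; exact: open_nbhs_nbhs.
elim: vs => [|v vs [g Fg IH]] /=; first by exists f.
have [k Fk gk] := DF g v Fg; exists k => // x Ax; rewrite -gk //.
apply: near_eq_derive; near=> y; apply: IH; near: y; exact: open_nbhs_nbhs.
Unshelve. all: by end_near. Qed.

Lemma smooth_on_differentiable (V W : normedModType R) (A : set V) (f : V -> W) x :
  smooth_on A f -> A x -> differentiable f x.
Proof. by move=> sf Ax; exact: (sf [::]). Qed.

Lemma smooth_on_derive (V W : normedModType R) (A : set V) (f : V -> W) v :
  smooth_on A f -> smooth_on A (fun x => 'D_v f x).
Proof. by move=> sf vs x Ax; have := sf (rcons vs v) x Ax; rewrite foldr_rcons. Qed.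

Lemma smooth_onW (V W : normedModType R) (A B : set V) (f : V -> W) :
  A `<=` B -> smooth_on B f -> smooth_on A f.
Proof. by move=> AB sf vs x /AB; exact: sf. Qed.

Lemma smooth_on_local (V W : normedModType R) (A : set V) (f : V -> W) :
  (forall x, A x -> exists B g, [/\ open B, B x, smooth_on B g &
     forall y, B y -> f y = g y]) -> smooth_on A f.
Proof.
move=> loc vs x Ax; have [B [g [oB Bx sg fg]]] := loc x Ax.
suff E : forall y, B y -> foldr (fun v h => (fun y => 'D_v h y)) f vs y =
    foldr (fun v h => (fun y => 'D_v h y)) g vs y.
  apply: near_eq_differentiable (sg vs x Bx).
  near=> y; apply/esym/E; near: y; exact: open_nbhs_nbhs.
elim: vs => [|v vs IH] //= y By; apply: near_eq_derive.
near=> z; apply: IH; near: z; exact: open_nbhs_nbhs.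
Unshelve. all: by end_near. Qed.

Lemma eq_smooth_on (V W : normedModType R) (A : set V) (f g : V -> W) :
  open A -> (forall x, A x -> f x = g x) -> smooth_on A g -> smooth_on A f.
Proof. by move=> oA fg sg; apply: smooth_on_local => x Ax; exists A, g. Qed.

Lemma smooth_on_cst (V W : normedModType R) (A : set V) (k : W) :
  smooth_on A (cst k).
Proof.
apply: (@smooth_onW _ _ _ setT) => //.
apply: (@smooth_onP _ _ _ [set f | exists k, f = cst k]) => //=;
  [exact: openT| | |by exists k].
- by move=> _ x [l ->] _.
- by move=> _ v [l ->]; exists (cst 0); [exists 0|move=> x _; exact: derive_cst].
Qed.

Lemma smooth_on_linear (V W : normedModType R) (A : set V) (l : {linear V -> W}) :
  continuous l -> smooth_on A l.
Proof.
move=> cl; apply: (@smooth_onW _ _ _ setT) => //.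
apply: (@smooth_onP _ _ _ [set f | (f = l :> (V -> W)) \/ exists k, f = cst k]) => //=;
  [exact: openT| | |by left].
- by move=> _ x [->|[k ->]] _ //; exact: linear_differentiable.
- move=> _ v [->|[k ->]]; [exists (cst (l v))|exists (cst 0)]; try by right; eexists.
    by move=> x _; rewrite deriveE ?diff_lin //; exact: linear_differentiable.
  by move=> x _; exact: derive_cst.
Qed.

Section Closure.
Variables (V W : normedModType R) (A : set V) (B : set W) (tau : V -> W).
Variables (I : finType) (e : I -> W) (l : I -> {linear W -> R}).
Hypotheses (oA : open A) (AB : forall x, A x -> B (tau x)).
Hypothesis coordE : forall w, w = \sum_i l i w *: e i.
Hypothesis dtau : forall x, A x -> differentiable tau x.
Hypothesis lC : forall i, continuous (l i).
Hypothesis stau : forall i, smooth_on A (l i \o tau).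

(** By the chain rule a derivative of [h \o tau] is a sum of products of derivatives of the
    coordinates of [tau] with functions composed with [tau]. Composition, sum and product are
    therefore closed up together, in one family stable under derivatives. *)
Inductive smooth_closure : (V -> R) -> Prop :=
| Closure_base k : smooth_on A k -> smooth_closure k
| Closure_comp h : smooth_on B h -> smooth_closure (h \o tau)
| Closure_add f g : smooth_closure f -> smooth_closure g -> smooth_closure (f + g)
| Closure_mul f g : smooth_closure f -> smooth_closure g -> smooth_closure (f * g).

Lemma smooth_closure_smooth_on : forall f, smooth_closure f -> smooth_on A f.
Proof.
have dcl g x : smooth_closure g -> A x -> differentiable g x.
  move=> + Ax; elim=> {g} [k|h sh|f g _ df _ dg|f g _ df _ dg].
  - by move=> /(smooth_on_differentiable); apply.
  - apply: differentiable_comp; first exact: dtau.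
    by apply: smooth_on_differentiable sh _; exact: AB.
  - exact: differentiableD.
  - exact: differentiableM.
apply: (smooth_onP oA (F := [set f | smooth_closure f])) => [g x|g v]; first exact: dcl.
elim=> {g} [k sk|h sh|f g cf [f' cf' ff'] cg [g' cg' gg']
           |f g cf [f' cf' ff'] cg [g' cg' gg']].
- by exists (fun x => 'D_v k x) => //; apply: Closure_base; exact: smooth_on_derive.
- exists (\sum_i ((fun x => 'D_v (l i \o tau) x) * ((fun y => 'D_(e i) h y) \o tau))).
    elim/big_ind: _ => [|f1 f2|i _]; first by apply: Closure_base; exact: smooth_on_cst.
      exact: Closure_add.
    apply: Closure_mul; first by apply: Closure_base; exact: smooth_on_derive.
    by apply: Closure_comp; exact: smooth_on_derive.
  move=> x Ax; have dh : differentiable h (tau x).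
    by apply: smooth_on_differentiable sh _; exact: AB.
  have dt := dtau Ax.
  have dlt i : 'D_v (l i \o tau) x = l i ('D_v tau x).
    have dl : differentiable (l i) (tau x) by exact/linear_differentiable/lC.
    rewrite [LHS]deriveE; last exact: differentiable_comp.
    rewrite (diff_comp dt dl) /= (diff_lin _ (@lC i)).
    by rewrite (deriveE v dt).
  rewrite deriveE; last exact: differentiable_comp.
  rewrite (diff_comp dt dh) /= -(deriveE v dt) (coordE ('D_v tau x)).
  rewrite linear_sum fct_sumE; apply: eq_bigr => i _.
  by rewrite linearZ /= !fctE /= dlt (deriveE (e i) dh) /GRing.scale.
- exists (f' + g'); first exact: Closure_add.
  move=> x Ax; rewrite deriveD; [|exact/diff_derivable/dcl..].
  by rewrite !fctE ff' ?gg'.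
- exists (f * g' + g * f'); first by apply: Closure_add; exact: Closure_mul.
  move=> x Ax; rewrite deriveM; [|exact/diff_derivable/dcl..].
  by rewrite !fctE ff' ?gg'.
Qed.

End Closure.
End SmoothOn.

(** * Algebra of smooth real functions and smooth cutoffs *)

Section SmoothAlgebra.
Context {R : realType}.

Definition coordL n (i : 'I_n) (x : 'rV[R]_n) : R := x ord0 i.

Lemma coordL_is_linear n (i : 'I_n) : linear (@coordL n i).
Proof. by move=> k x y; rewrite /coordL !mxE. Qed.
HB.instance Definition _ n (i : 'I_n) :=
  GRing.isLinear.Build R 'rV[R]_n R _ (@coordL n i) (@coordL_is_linear n i).

Lemma coordL_continuous n (i : 'I_n) : continuous (@coordL n i).
Proof. exact: coord_continuous. Qed.

Lemma row_sum_coordL n (x : 'rV[R]_n) :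
  x = \sum_i coordL i x *: delta_mx ord0 i.
Proof. exact: row_sum_delta. Qed.

Lemma smooth_on_coordL n (i : 'I_n) A : smooth_on A (@coordL n i).
Proof. by apply: smooth_on_linear; exact: coordL_continuous. Qed.

Section Closure.
Variables (V : normedModType R) (A : set V).
Hypothesis oA : open A.
Implicit Types f g : V -> R.

Lemma smooth_on_comp_row n (B : set 'rV[R]_n) (tau : V -> 'rV[R]_n) (h : 'rV[R]_n -> R) :
  (forall x, A x -> B (tau x)) -> (forall x, A x -> differentiable tau x) ->
  (forall i, smooth_on A (coordL i \o tau)) -> smooth_on B h ->
  smooth_on A (h \o tau).
Proof.
move=> AB dt st sh.
apply: (@smooth_closure_smooth_on _ _ _ A B tau 'I_n (delta_mx ord0)
  (@coordL n)) => //.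
- exact: row_sum_coordL.
- exact: coordL_continuous.
- exact: Closure_comp.
Qed.

(** The real line as a space with a one-element basis, so that [smooth_closure] also covers
    composition with functions of one real variable. *)
Lemma sum_unitE (w : R) : w = \sum_(i : unit) (idfun : {linear R -> R}) w *: (1 : R).
Proof. by rewrite (big_pred1 tt) => [|[]//]; rewrite [_%:A]mulr1. Qed.

Lemma smooth_on_comp_real (B : set R) f (h : R -> R) :
  (forall x, A x -> B (f x)) -> smooth_on A f -> smooth_on B h ->
  smooth_on A (h \o f).
Proof.
move=> AB st sh.
apply: (@smooth_closure_smooth_on _ _ _ A B f unit (fun=> 1) (fun=> idfun)) => //.
- exact: sum_unitE.
- by move=> x Ax; apply: smooth_on_differentiable st Ax.
- by move=> _ x; exact: cvg_id.
- exact: Closure_comp.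
Qed.

Lemma smooth_onDM f g : smooth_on A f -> smooth_on A g ->
  smooth_on A (f + g) /\ smooth_on A (f * g).
Proof.
(* Only the base, sum and product clauses matter here; the inner map [tau] is taken to be
   constant. *)
move=> sf sg; have H : forall k, @smooth_closure R V R A setT (cst 0) k -> smooth_on A k.
  apply: (@smooth_closure_smooth_on R V R A setT (cst 0) unit (fun=> 1)
    (fun=> idfun)) => //; first exact: sum_unitE.
    by move=> _ x; exact: cvg_id.
  by move=> _; exact: smooth_on_cst.
by split; apply: H; [apply: Closure_add|apply: Closure_mul]; exact: Closure_base.
Qed.

Lemma smooth_onD f g : smooth_on A f -> smooth_on A g -> smooth_on A (fun x => f x + g x).
Proof. by move=> sf sg; have [] := smooth_onDM sf sg. Qed.

Lemma smooth_onM f g : smooth_on A f -> smooth_on A g -> smooth_on A (fun x => f x * g x).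
Proof. by move=> sf sg; have [] := smooth_onDM sf sg. Qed.

Lemma smooth_on_scale (k : R) f : smooth_on A f -> smooth_on A (fun x => k * f x).
Proof. by move=> sf; apply: smooth_onM => //; exact: smooth_on_cst. Qed.

Lemma smooth_onN f : smooth_on A f -> smooth_on A (fun x => - f x).
Proof.
move=> /(smooth_on_scale (-1)); apply: eq_smooth_on => // x _.
by rewrite mulN1r.
Qed.

Lemma smooth_onB f g : smooth_on A f -> smooth_on A g -> smooth_on A (fun x => f x - g x).
Proof. by move=> sf sg; apply: smooth_onD => //; exact: smooth_onN. Qed.

Lemma smooth_on_sum (I : finType) (f : I -> V -> R) :
  (forall i, smooth_on A (f i)) -> smooth_on A (fun x => \sum_i f i x).
Proof.
move=> sf; rewrite -(_ : \sum_i f i = fun x => \sum_i f i x); last first.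
  by apply/funext => x; rewrite fct_sumE.
elim/big_ind: _ => [|f1 f2|i _]; [exact: smooth_on_cst|exact: smooth_onD|exact: sf].
Qed.

Lemma smooth_onX (n : nat) f : smooth_on A f -> smooth_on A (fun x => f x ^+ n).
Proof.
move=> sf; elim: n => [|n IH]; first exact: smooth_on_cst.
apply: (eq_smooth_on oA (g := fun x => f x * f x ^+ n)) => [x _|]; first exact: exprS.
exact: smooth_onM.
Qed.

End Closure.

(** In one variable the derivative in the direction [v] is [v] times the ordinary derivative, so
    stability under scalar multiples takes care of all directions. *)
Lemma smooth_on_realP (A : set R) (F : set (R -> R)) : open A ->
  (forall f, F f -> exists2 g, F g & forall x, A x -> is_derive x (1 : R) f (g x)) ->
  (forall f k, F f -> F (fun x => k * f x)) ->
  forall f, F f -> smooth_on A f.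
Proof.
move=> oA DF ZF f; apply: (smooth_onP oA) => {f} [f x Ff Ax|f v Ff].
  by have [g _ fg] := DF f Ff; apply/derivable1_diffP; have [] := fg x Ax.
have [g Fg fg] := DF f Ff; exists (fun x => v * g x); first exact: ZF.
move=> x Ax; have [d1 <-] := fg x Ax.
have df : differentiable f x by exact/derivable1_diffP.
by rewrite !(deriveE _ df) -{1}[v]mulr1 -[v * 1]/(v *: (1 : R)) linearZ.
Qed.

Lemma open_neq0 : open [set x : R | x != 0].
Proof.
rewrite (_ : [set x | _] = ~` [set 0]).
  by apply: closed_openC; exact: closed_eq.
by apply/seteqP; split => x /eqP.
Qed.

Lemma smooth_on_inv : smooth_on [set x : R | x != 0] (fun x => x^-1).
Proof.
pose F := [set f : R -> R | exists k n, f = fun x => k * x^-1 ^+ n].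
have : F (fun x => x^-1) by exists 1, 1%N; apply/funext => x; rewrite mul1r.
apply: (smooth_on_realP open_neq0) => [_ [k [n ->]]|_ l [k [n ->]]]; last first.
  by exists (l * k), n; apply/funext => x; rewrite mulrA.
exists (fun x => - (k * n%:R) * x^-1 ^+ n.+1); first by eexists; eexists.
move=> x /= x0; rewrite (_ : (fun x => k * x^-1 ^+ n) =
    k \*: ((fun y => y^-1) ^+ n)); last first.
  by apply/funext => y; rewrite exprfctE.
have dV : is_derive x (1 : R) (fun y : R => y^-1) (- x ^- 2 *: (1 : R)).
  apply: DeriveDef; first exact: (derivableV (f := id)).
  by rewrite (deriveV (f := id)) // derive_id.
apply: is_derive_eq.
case: n => [|n] /=; rewrite /GRing.scale /=; first by rewrite mulr0n; ring.
by rewrite -exprVn -mulr_natr !exprS; ring.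
Qed.

Lemma smooth_onV (V : normedModType R) (A : set V) (f : V -> R) : open A ->
  (forall x, A x -> f x != 0) -> smooth_on A f -> smooth_on A (fun x => (f x)^-1).
Proof. by move=> oA f0 sf; apply: smooth_on_comp_real smooth_on_inv. Qed.

(** The classical function all of whose derivatives vanish at 0; every cutoff below is built from
    it. *)
Definition flat (x : R) : R := if 0 < x then expR (- x^-1) else 0.

(** From 1 + y/n <= exp(y/n) one gets y <= n exp(y/n); raising this to the power n gives the
    bound. *)
Lemma exprn_expRN_le (n : nat) (y : R) : 0 < y -> y ^+ n * expR (- y) <= n%:R ^+ n.
Proof.
move=> y0; rewrite expRN ler_pdivrMr ?expR_gt0 //.
case: n => [|n]; first by rewrite !expr0 mul1r -expR0 ler_expR ltW.
have -> : expR y = expR (y / n.+1%:R) ^+ n.+1.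
  by rewrite -expRM_natl mulrCA divff ?mulr1.
have e0 : 0 <= n.+1%:R * expR (y / n.+1%:R) by rewrite mulr_ge0 // expR_ge0.
rewrite -exprMn ler_pXn2r ?nnegrE ?(ltW y0) //.
rewrite -ler_pdivrMl // mulrC (le_trans _ (expR_ge1Dx _)) //.
by rewrite lerDr.
Qed.

Lemma poly_expRN_bounded (p : {poly R}) :
  exists C, forall y, 0 < y -> `|p.[y] * expR (- y)| <= C.
Proof.
exists (\sum_(i < size p) `|p`_i| * i%:R ^+ i) => y y0.
rewrite horner_coef mulr_suml (le_trans (ler_norm_sum _ _ _)) //.
apply: ler_sum => i _; rewrite -mulrA normrM ler_wpM2l //.
by rewrite ger0_norm ?exprn_expRN_le // mulr_ge0 ?expR_ge0 ?exprn_ge0 // ltW.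
Qed.

(** The family stable under derivatives consists of the functions p(1/x) exp(-1/x), extended by 0 to
    x <= 0, for all polynomials p. *)
Lemma smooth_on_flat : smooth_on setT flat.
Proof.
pose G (p : {poly R}) x := if 0 < x then p.[x^-1] * expR (- x^-1) else 0.
pose F := [set f | exists p, f = G p].
have : F flat by exists 1; apply/funext => x; rewrite /flat /G hornerC mul1r.
apply: (smooth_on_realP openT) => [_ [p ->]|_ k [p ->]]; last first.
  exists (k *: p); apply/funext => x; rewrite /G hornerZ.
  by case: ifP => _; rewrite ?mulr0 ?mulrA.
(* With y = 1/x one has dy/dx = -y^2, so the derivative of p(y) exp(-y) in x is y^2 (p(y) - p'(y))
   exp(-y). *)
exists (G ('X ^+ 2 * (p - p^`()))); first by eexists.
move=> x _; set q := _ * _.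
have -> : G q x = if 0 < x then q.[x^-1] * expR (- x^-1) else 0 by [].
case: (ltgtP 0 x) => x0.
- apply: (@near_eq_is_derive R R R (fun x => p.[x^-1] * expR (- x^-1)) (G p) x 1).
    by near=> y; rewrite /G ifT //; near: y; exact: lt_nbhsr.
  have dV : is_derive x (1 : R) (fun y : R => y^-1) (- x ^- 2 *: (1 : R)).
    have x0' : x != 0 by rewrite gt_eqF.
    apply: DeriveDef; first exact: (derivableV (f := id)).
    by rewrite (deriveV (f := id)) // derive_id.
  have dp := is_derive1_comp (is_derive_poly p x^-1) dV.
  have de := is_derive1_comp (f := expR) (is_derive_expR _) (is_deriveN dV).
  have dM := is_deriveM dp de.
  rewrite (_ : _ * _ =
      (horner p \o GRing.inv) x *: (expR ((- GRing.inv) x) * - (- x ^- 2)%:A) +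
      (expR \o (- GRing.inv)) x *: (p^`().[x^-1] * (- x ^- 2)%:A)).
    exact: dM.
  rewrite /GRing.scale /= /q !hornerE /= -exprVn.
  by ring.
- apply: (@near_eq_is_derive R R R (cst 0) (G p) x 1).
    near=> y; rewrite /G ifF //; apply/negbTE; rewrite -leNgt ltW //.
    by near: y; exact: lt_nbhsl.
(* At 0, boundedness of y^2 p(y) exp(-y) at y = 1/h gives a bound of order h^2 on [G p h], so the
   difference quotient tends to 0. *)
- have [C hC] := poly_expRN_bounded ('X ^+ 2 * p).
  have Gle h : `|G p h| <= `|C| * h ^+ 2.
    rewrite /G; case: ifPn => h0; last by rewrite normr0 mulr_ge0 ?sqr_ge0.
    have := hC h^-1; rewrite invr_gt0 => /(_ h0) /le_trans/(_ (ler_norm _)).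
    rewrite hornerM hornerXn -mulrA normrM ger0_norm ?sqr_ge0 // exprVn.
    by rewrite ler_pdivrMl ?exprn_gt0 // [`|C| * _]mulrC.
  have H : h^-1 *: ((G p \o shift x) (h *: (1 : R)) - G p x) @[h --> 0^'] --> (0 : R).
    apply/cvgrPdist_le => e e0; near=> k; rewrite sub0r normrN -x0 /= addr0.
    rewrite [_%:A]mulr1 {2}/G ltxx subr0 normrZ.
    have k0 : k != 0 by near: k; exact: nbhs_dnbhs_neq.
    rewrite normfV ler_pdivrMl ?normr_gt0 //.
    apply: (le_trans (Gle k)); rewrite -real_normK ?num_real // expr2 mulrCA.
    rewrite ler_wpM2l //.
    have ke : `|k| <= e / (`|C| + 1).
      by near: k; apply: dnbhs0_le; rewrite divr_gt0 // ltr_wpDl.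
    have C1 : 0 < `|C| + 1 by rewrite ltr_wpDl.
    move: ke; rewrite ler_pdivlMr //.
    by apply: le_trans; rewrite mulrC ler_wpM2l // lerDl.
  by apply: DeriveDef; [apply/cvg_ex; exists 0|apply: cvg_lim].
Unshelve. all: by end_near. Qed.

Lemma flat_gt0 x : (0 < flat x) = (0 < x).
Proof. by rewrite /flat; case: ifP => //; rewrite ?expR_gt0 ?ltxx. Qed.

Lemma flat_ge0 x : 0 <= flat x.
Proof. by rewrite /flat; case: ifP => // _; exact: expR_ge0. Qed.

Lemma flat_eq0 x : x <= 0 -> flat x = 0.
Proof. by rewrite /flat ltNge => ->. Qed.

(** At least one of x and 1 - x is positive. This sum is the denominator of the cutoff functions. *)
Lemma flatD_gt0 x : 0 < flat x + flat (1 - x).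
Proof.
have [x0|x0] := ltP 0 x; first by rewrite ltr_pwDl ?flat_ge0 ?flat_gt0.
by rewrite ltr_wpDl ?flat_ge0 ?flat_gt0 // subr_gt0 (le_lt_trans x0).
Qed.

Lemma coord_le_norm n (x : 'rV[R]_n) i : `|x ord0 i| <= `|x|.
Proof.
rewrite -[`|x|]/(mx_norm x) mx_normrE.
exact: (le_bigmax _ (fun ij => `|x ij.1 ij.2|) (ord0, i)).
Qed.

Lemma norm_coordE n (x : 'rV[R]_n) : `|x| != 0 -> exists i, `|x| = `|x ord0 i|.
Proof. by move=> /mx_norm_neq0 [[j i] xi]; exists i; move: xi; rewrite /= (ord1 j). Qed.

Lemma smooth_bump n (p : 'rV[R]_n) (r : R) : 0 < r ->
  exists chi : 'rV[R]_n -> R, [/\ smooth_on setT chi,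
    forall x, r <= `|x - p| -> chi x = 0 & \forall x \near p, chi x = 1].
Proof.
move=> r0.
(* The norm is the maximum norm, which is not smooth, so a sum of squares replaces it. At [p] the
   value is 2, and it is at most 0 as soon as one coordinate of [x - p] has absolute value at least
   [r]. *)
pose q x := 2 - 2 / r ^+ 2 * \sum_i (coordL i x - coordL i p) ^+ 2.
have sq : smooth_on setT q.
  apply: smooth_onB => //; [exact: openT|exact: smooth_on_cst|].
  apply: smooth_on_scale; [exact: openT|].
  apply: smooth_on_sum => [|i]; first exact: openT.
  apply: smooth_onX; first exact: openT.
  apply: smooth_onB; [exact: openT|exact: smooth_on_coordL|exact: smooth_on_cst].
have oT : open [set: 'rV[R]_n] by exact: openT.
(* The quotient is 0 where [q x <= 0] and 1 where [1 <= q x]; the latter holds near [p], where [q]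
   is close to 2. *)
exists (fun x => flat (q x) * (flat (q x) + flat (1 - q x))^-1); split.
- have sf : smooth_on setT (fun x => flat (q x)).
    exact: smooth_on_comp_real smooth_on_flat.
  apply: smooth_onM => //; apply: smooth_onV => //.
    by move=> x _; rewrite gt_eqF // flatD_gt0.
  apply: smooth_onD => //.
  apply: (smooth_on_comp_real _ _ _ smooth_on_flat) => //.
  by apply: smooth_onB => //; exact: smooth_on_cst.
- move=> x rx; rewrite flat_eq0 ?mul0r // subr_le0.
  have [|i xi] := @norm_coordE _ (x - p); first by rewrite gt_eqF // (lt_le_trans r0).
  rewrite -mulrA ler_pMr // mulrC ler_pdivlMr ?exprn_gt0 // mul1r.
  rewrite (bigD1 i) //= ler_wpDr ?sumr_ge0 // => [k _|]; first exact: sqr_ge0.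
  rewrite xi in rx; rewrite -[leRHS]real_normK ?num_real //.
  rewrite ler_pXn2r ?nnegrE ?(ltW r0) //.
  by rewrite /coordL; rewrite !mxE in rx.
- have qp : q p = 2 by rewrite /q big1 ?mulr0 ?subr0 // => i _; rewrite subrr expr0n.
  have cq : {for p, continuous q}.
    by apply: differentiable_continuous; exact: smooth_on_differentiable sq _.
  near=> x; have q1 : 1 <= q x.
    by apply: ltW; near: x; apply: (cvgr_gt (q p)) => //; rewrite qp ltr1n.
  rewrite [flat (1 - _)]flat_eq0 ?subr_le0 // addr0 divff // gt_eqF // flat_gt0.
  exact: lt_le_trans q1.
Unshelve. all: by end_near. Qed.

End SmoothAlgebra.

(** * Symmetry of second derivatives *)

Section SecondOrder.
Context {R : realType}.

(** Turns directional derivatives into derivatives of one real variable, to which the mean value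
    theorem and the fundamental theorem of calculus apply. *)
Lemma is_derive_line (V W : normedModType R) (f : V -> W) (z w : V) (s : R) :
  differentiable f (z + s *: w) ->
  is_derive s (1 : R) (fun t => f (z + t *: w)) ('D_w f (z + s *: w)).
Proof.
move=> df; have dw := @diff_derivable _ _ _ _ _ w df.
have E : (fun h : R => h^-1 *: (((fun t => f (z + t *: w)) \o shift s) (h *: (1 : R))
    - f (z + s *: w))) =
    (fun h : R => h^-1 *: ((f \o shift (z + s *: w)) (h *: w) - f (z + s *: w))).
  apply/funext => h /=; rewrite [h%:A]mulr1 scalerDl.
  by congr (_ *: (f _ - _)); rewrite addrCA.
by apply: DeriveDef; rewrite /derivable /derive E.
Qed.

Lemma MVT0 (f df : R -> R) (s : R) : 0 < s ->
  (forall x, 0 <= x <= s -> is_derive x (1 : R) f (df x)) ->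
  exists2 c, 0 <= c <= s & f s - f 0 = df c * s.
Proof.
move=> s0 dfE.
have [x||c cs ->] := @MVT R f df 0 s s0.
- by rewrite in_itv /= => /andP[x0 xs]; apply: dfE; rewrite !ltW.
- apply: derivable_within_continuous => x; rewrite in_itv /= => xs.
  by have [] := dfE x xs.
- exists c; last by rewrite subr0.
  by move: cs; rewrite in_itv /= => /andP[x0 xs]; rewrite !ltW.
Qed.

(** The mean value theorem is applied twice: along [v] to the difference of [f] on two opposite
    sides of the parallelogram, then along [w] to the derivative so obtained. *)
Lemma second_difference (V : normedModType R) (A : set V) (f : V -> R) (x v w : V)
    (s : R) : 0 < s -> smooth_on A f ->
  (forall a b, 0 <= a <= s -> 0 <= b <= s -> A (x + a *: v + b *: w)) ->
  exists a b, [/\ 0 <= a <= s, 0 <= b <= s &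
    f (x + s *: v + s *: w) - f (x + s *: v) - f (x + s *: w) + f x =
    s ^+ 2 * 'D_w (fun y => 'D_v f y) (x + a *: v + b *: w)].
Proof.
move=> s0 sf Axs.
have df y : A y -> differentiable f y by exact: smooth_on_differentiable.
have dDf y : A y -> differentiable (fun y => 'D_v f y) y.
  by apply: smooth_on_differentiable; exact: smooth_on_derive.
have ss : 0 <= s <= s by rewrite (ltW s0) lexx.
have s00 : 0 <= (0 : R) <= s by rewrite (ltW s0) lexx.
pose u a := f (x + s *: w + a *: v) - f (x + a *: v).
have [|a as0 ua] := @MVT0 u (fun a => 'D_v f (x + s *: w + a *: v) - 'D_v f (x + a *: v)) s s0.
  move=> a aS; apply: is_deriveB; apply: is_derive_line; apply: df.
    by rewrite addrAC; exact: Axs.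
  by rewrite -[_ + _]addr0 -(scale0r w); exact: Axs.
have [|b bs0 ub] := @MVT0 (fun b => 'D_v f (x + a *: v + b *: w))
  (fun b => 'D_w (fun y => 'D_v f y) (x + a *: v + b *: w)) s s0.
  by move=> b bS; apply: is_derive_line; apply: dDf; exact: Axs.
exists a, b; split => //.
move: ua; rewrite (addrAC x (s *: w) (a *: v)).
move: ub; rewrite scale0r addr0 => ->; rewrite /u !scale0r !addr0 => E.
by rewrite expr2 -mulrA [s * 'D_w _ _]mulrC [RHS]mulrC -E (addrAC x (s *: w)); ring.
Qed.

(** The second difference is symmetric in [v] and [w]. Hence the two mixed derivatives take a common
    value at two points arbitrarily close to [x], and both are continuous at [x]. *)
Lemma derive_comm (V : normedModType R) (A : set V) (f : V -> R) (x v w : V) :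
  open A -> smooth_on A f -> A x ->
  'D_w (fun y => 'D_v f y) x = 'D_v (fun y => 'D_w f y) x.
Proof.
move=> oA sf Ax.
have [F FE] : exists F, forall y, F y = 'D_w (fun y => 'D_v f y) y.
  exact (ex_intro _ (fun y => 'D_w (fun y => 'D_v f y) y) (fun=> erefl)).
have [G GE] : exists G, forall y, G y = 'D_v (fun y => 'D_w f y) y.
  exact (ex_intro _ (fun y => 'D_v (fun y => 'D_w f y) y) (fun=> erefl)).
rewrite -FE -GE.
have cF : {for x, continuous F}.
  apply: differentiable_continuous; apply: smooth_on_differentiable Ax.
  by rewrite (funext FE); do 2 apply: smooth_on_derive.
have cG : {for x, continuous G}.
  apply: differentiable_continuous; apply: smooth_on_differentiable Ax.
  by rewrite (funext GE); do 2 apply: smooth_on_derive.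
apply/eqP; rewrite -subr_eq0 -normr_le0; apply/ler_addgt0Pl => e e0; rewrite addr0.
have e20 : 0 < e / 2 by rewrite divr_gt0.
have /cvgrPdist_lt/(_ _ e20) nF := cF.
have /cvgrPdist_lt/(_ _ e20) nG := cG.
have /nbhs_ballP [d d0 dH] : nbhs x (A `&` ([set y | `|F x - F y| < e / 2] `&`
    [set y | `|G x - G y| < e / 2])).
  by apply: filterI (filterI nF nG); exact: open_nbhs_nbhs.
(* This side length keeps the whole parallelogram within distance [d] of [x]; the summand 1 covers
   the case of two zero directions. *)
pose s := d / (`|v| + `|w| + 1).
have N0 : 0 < `|v| + `|w| + 1 by rewrite ltr_wpDl // addr_ge0.
have s0 : 0 < s by rewrite divr_gt0.
have inb a b : 0 <= a <= s -> 0 <= b <= s -> ball x d (x + a *: v + b *: w).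
  move=> /andP[a0 as0] /andP[b0 bs0]; rewrite -ball_normE /=.
  rewrite -addrA opprD addNKr normrN (le_lt_trans (ler_normD _ _)) //.
  rewrite !normrZ !ger0_norm // (@le_lt_trans _ _ (s * (`|v| + `|w|))) //.
    by rewrite mulrDr lerD // ler_wpM2r.
  by rewrite /s mulrAC ltr_pdivrMr // ltr_pM2l // ltrDl.
have [|a [b [as0 bs0 E1]]] := second_difference s0 sf (x := x) (v := v) (w := w).
  by move=> a b ha hb; have [] := dH _ (inb a b ha hb).
have [|b' [a' [bs0' as0' E2]]] := second_difference s0 sf (x := x) (v := w) (w := v).
  by move=> a' b' ha hb; rewrite addrAC; have [] := dH _ (inb b' a' hb ha).
have [_ [FF _]] := dH _ (inb a b as0 bs0).
have [_ [_ GG]] := dH _ (inb a' b' as0' bs0').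
have E : F (x + a *: v + b *: w) = G (x + a' *: v + b' *: w).
  apply: (@mulfI _ (s ^+ 2)); first by rewrite expf_neq0 // gt_eqF.
  rewrite FE -E1 GE (addrAC x (a' *: v)) -E2 (addrAC x (s *: w)); ring.
rewrite (_ : F x - G x = (F x - F (x + a *: v + b *: w)) -
  (G x - G (x + a' *: v + b' *: w))); last by rewrite E; ring.
rewrite (le_trans (ler_normB _ _)) // [e in leRHS]splitr.
by rewrite lerD // ltW.
Unshelve. all: by end_near. Qed.

End SecondOrder.

(** * Hadamard's lemma *)

Section Integral01.
Context {R : realType}.
Implicit Types f g : R -> R.

Let mu := @lebesgue_measure R.

Definition int01 f : R := Rintegral mu `[0, 1] f.

(** Two-sided continuity, also at the end points. The integrands come from functions smooth on an
    open ball containing the segment, so this is available and avoids subspace topologies. *)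
Definition cont01 f := forall t : R, 0 <= t <= 1 -> {for t, continuous f}.

Lemma cont01_within f : cont01 f -> {within `[0, 1], continuous f}.
Proof.
move=> cf; apply/subspace_continuousP => x; rewrite /= in_itv /= => x01.
by apply: cvg_within_filter; exact: cf.
Qed.

Lemma cont01B f g : cont01 f -> cont01 g -> cont01 (fun t => f t - g t).
Proof. by move=> cf cg t t01; apply: continuousB; [exact: cf|exact: cg]. Qed.

Lemma cont01Z k f : cont01 f -> cont01 (fun t => k * f t).
Proof. by move=> cf t t01; apply: cvgMr; exact: cf. Qed.

Lemma cont01_integrable f : cont01 f -> mu.-integrable `[0, 1] (EFin \o f).
Proof.
move=> cf; apply: continuous_compact_integrable; first exact: segment_compact.
exact: cont01_within.
Qed.

Lemma int01D f g : cont01 f -> cont01 g ->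
  int01 (fun t => f t + g t) = int01 f + int01 g.
Proof. by move=> cf cg; apply: RintegralD => //; exact: cont01_integrable. Qed.

Lemma int01B f g : cont01 f -> cont01 g ->
  int01 (fun t => f t - g t) = int01 f - int01 g.
Proof. by move=> cf cg; apply: RintegralB => //; exact: cont01_integrable. Qed.

Lemma int01Z k f : cont01 f -> int01 (fun t => k * f t) = k * int01 f.
Proof. by move=> cf; apply: RintegralZl => //; exact: cont01_integrable. Qed.

Lemma eq_int01 f g : (forall t, 0 <= t <= 1 -> f t = g t) -> int01 f = int01 g.
Proof.
move=> fg; apply: eq_Rintegral => t /set_mem; rewrite /= in_itv /=; exact: fg.
Qed.

Lemma int01_cst C : int01 (cst C) = C.
Proof.
rewrite /int01 Rintegral_cst // [X in fine X](_ : _ = 1%:E) ?mulr1 //.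
by rewrite /mu; apply: etrans (lebesgue_measure_itv _) _; rewrite /= lte_fin ltr01 sube0.
Qed.

Lemma int01_le f C : cont01 f -> (forall t, 0 <= t <= 1 -> `|f t| <= C) ->
  `|int01 f| <= C.
Proof.
move=> cf fC; apply: le_trans (le_normr_Rintegral _ (cont01_integrable cf)) _ => //.
rewrite -(int01_cst C).
apply: le_Rintegral => //.
- by apply: cont01_integrable => t t01; apply: cvg_norm; exact: cf.
- by apply: cont01_integrable => t t01; exact: cvg_cst.
Qed.

Lemma int01_derive (F f : R -> R) : cont01 f ->
  (forall t : R, 0 <= t <= 1 -> is_derive t (1 : R) F (f t)) ->
  int01 f = F 1 - F 0.
Proof.
move=> cf dF; have cF : cont01 F.
  move=> t t01; apply: differentiable_continuous; apply/derivable1_diffP.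
  by have [] := dF t t01.
rewrite /int01 /Rintegral (@continuous_FTC2 _ _ F) //.
- exact: cont01_within.
- split.
  + by move=> t; rewrite in_itv /= => /andP[t0 t1]; have [] := dF t _; rewrite ?ltW.
  + by apply: cvg_at_right_filter; apply: cF; rewrite lexx ler01.
  + by apply: cvg_at_left_filter; apply: cF; rewrite lexx ler01.
- move=> t; rewrite in_itv /= => /andP[t0 t1]; rewrite derive1E.
  by have [|_ ->] := dF t _; rewrite ?ltW.
Qed.

End Integral01.

(** * Taylor remainders and differentiation under the integral sign *)

Section Hadamard.
Context {R : realType}.

Lemma scaleRE (a x : R) : a *: x = a * x. Proof. by []. Qed.

Lemma closed_ball_compact n (p : 'rV[R]_n) (s : R) : 0 < s -> compact (closed_ball p s).
Proof.
move=> s0; apply: bounded_closed_compact; last exact: closed_ball_closed.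
exists (`|p| + s); split; first exact: num_real.
move=> M ltM z; rewrite closed_ballE // /closed_ball_ /= distrC => zK.
have zp := ler_normD (z - p) p; rewrite subrK in zp.
by apply: (le_trans zp); rewrite addrC (le_trans _ (ltW ltM)) // lerD2l.
Qed.

(** A quadratic remainder is negligible against [y], so the candidate [L] is the differential. An
    explicit bound, unlike a little-o, survives integration over a parameter. *)
Lemma differentiable_quadratic (V W : normedModType R) (f : V -> W) (x : V)
    (L : {linear V -> W}) (C d : R) : continuous L -> 0 < d ->
  (forall y, `|y| < d -> `|f (x + y) - f x - L y| <= C * `|y| ^+ 2) ->
  differentiable f x /\ forall v, 'D_v f x = L v.
Proof.
move=> cL d0 fL.
have H : f \o shift x = cst (f x) + L +o_ 0 id.
  apply/eqaddoP => e e0.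
  have C0 : 0 < `|C| + 1 by rewrite ltr_wpDl.
  near=> y; rewrite !fctE /= opprD addrA (addrC y x).
  have yd : `|y| < d by near: y; exact: nbhs0_lt.
  apply: (le_trans (fL y yd)).
  have ye : `|y| <= e / (`|C| + 1) by near: y; apply: nbhs0_le; rewrite divr_gt0.
  rewrite expr2 mulrA ler_wpM2r //.
  move: ye; rewrite ler_pdivlMr //; apply: le_trans; rewrite mulrC ler_wpM2l //.
  by rewrite (le_trans (ler_norm C)) // lerDl.
have df : differentiable f x by apply/diff_locallyP; rewrite (diff_unique cL H).
by split=> // v; rewrite (deriveE _ df) (diff_unique cL H).
Unshelve. all: by end_near. Qed.

Lemma continuous_compact_bound (T : topologicalType) (K : set T) (f : T -> R) :
  compact K -> (forall z, K z -> {for z, continuous f}) ->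
  exists2 C, 0 <= C & forall z, K z -> `|f z| <= C.
Proof.
move=> cK cf.
have cfK : compact (f @` K).
  apply: continuous_compact cK; apply/subspace_continuousP => x Kx.
  by apply: cvg_within_filter; exact: cf.
have [M [_ MP]] := compact_bounded cfK.
exists (`|M| + 1); first by rewrite addr_ge0.
move=> z Kz; apply: (MP (`|M| + 1)); last by exists z.
by rewrite (le_lt_trans (ler_norm M)) // ltrDl.
Qed.

(** Two applications of the mean value theorem, with both intermediate parameters at most 1. The
    factor 1/2 of the sharp remainder is given up. *)
Lemma taylor_bound (V : normedModType R) (A : set V) (f : V -> R) (z w : V) (C : R) :
  smooth_on A f -> (forall s, 0 <= s <= 1 -> A (z + s *: w)) ->
  (forall s, 0 <= s <= 1 -> `|'D_w (fun y => 'D_w f y) (z + s *: w)| <= C) ->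
  `|f (z + w) - f z - 'D_w f z| <= C.
Proof.
move=> sf Az bC.
have df y : A y -> differentiable f y by exact: smooth_on_differentiable.
have dDf y : A y -> differentiable (fun y => 'D_w f y) y.
  by apply: smooth_on_differentiable; exact: smooth_on_derive.
have [|s /andP[s0 s1]] := @MVT0 R (fun s => f (z + s *: w)) (fun s => 'D_w f (z + s *: w)) 1 ltr01.
  by move=> s s01; apply: is_derive_line; apply: df; exact: Az.
rewrite scale1r scale0r addr0 mulr1 => ->.
have C0 : 0 <= C by apply: le_trans (bC 0 _) => //; rewrite lexx ler01.
move: s0; rewrite le_eqVlt => /predU1P[<-|s0].
  by rewrite scale0r addr0 subrr normr0.
have [|u /andP[u0 us]] := @MVT0 R (fun s => 'D_w f (z + s *: w))
   (fun s => 'D_w (fun y => 'D_w f y) (z + s *: w)) s s0.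
  move=> t /andP[t0 ts]; apply: is_derive_line; apply: dDf; apply: Az.
  by rewrite t0 (le_trans ts).
rewrite scale0r addr0 => ->; rewrite normrM (gtr0_norm s0).
apply: le_trans (_ : C * s <= C); last by rewrite ler_piMr.
by rewrite ler_wpM2r ?(ltW s0) // bC // u0 (le_trans us).
Qed.

Lemma derive_row_sum n (W : normedModType R) (f : 'rV[R]_n -> W) x v : differentiable f x ->
  'D_v f x = \sum_i coordL i v *: 'D_(delta_mx ord0 i) f x.
Proof.
move=> df; rewrite (deriveE _ df) {1}(row_sum_coordL v) linear_sum.
by apply: eq_bigr => i _; rewrite linearZ (deriveE _ df).
Qed.

(** Each of the finitely many second partial derivatives is bounded on the compact set. Both
    occurrences of [w] are expanded in the basis, the inner one after exchanging the two derivatives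
    with [derive_comm]. *)
Lemma second_derive_bound n (A K : set 'rV[R]_n) (f : 'rV[R]_n -> R) :
  open A -> smooth_on A f -> compact K -> K `<=` A ->
  exists2 C, 0 <= C & forall z w, K z ->
    `|'D_w (fun y => 'D_w f y) z| <= C * `|w| ^+ 2.
Proof.
move=> oA sf cK KA.
pose d i j y := 'D_(delta_mx ord0 j) (fun y => 'D_(delta_mx ord0 i) f y) y.
have /choice [C CP] (ij : 'I_n * 'I_n) : exists C, 0 <= C /\ forall z, K z ->
    `|d ij.1 ij.2 z| <= C.
  have [|C C0 CP] := @continuous_compact_bound _ K (d ij.1 ij.2) cK; last by exists C.
  move=> z /KA Az; apply: differentiable_continuous.
  apply: (smooth_on_differentiable _ Az).
  by do 2 apply: smooth_on_derive.
exists (\sum_i \sum_j C (i, j)).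
  by do 2 apply: sumr_ge0 => ? _; exact: (CP (_, _)).1.
move=> z w Kz; have Az := KA z Kz.
rewrite derive_row_sum; last first.
  by apply: (smooth_on_differentiable _ Az); exact: smooth_on_derive.
rewrite mulr_suml (le_trans (ler_norm_sum _ _ _)) //; apply: ler_sum => i _.
rewrite (derive_comm w _ oA sf Az) derive_row_sum; last first.
  by apply: (smooth_on_differentiable _ Az); exact: smooth_on_derive.
rewrite normrZ mulr_suml.
rewrite (@le_trans _ _ (`|w| * \sum_j (`|w| * C (i, j)))) //.
  rewrite ler_pM ?coord_le_norm // (le_trans (ler_norm_sum _ _ _)) //.
  apply: ler_sum => j _; rewrite normrZ ler_pM ?coord_le_norm //.
  exact: (CP (i, j)).2.
rewrite mulr_sumr; apply: ler_sum => j _.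
by rewrite expr2 mulrA mulrC.
Qed.

Variables (n : nat) (p : 'rV[R]_n) (r : R).
Implicit Types h : 'rV[R]_n -> R.

(* The moments of order 0 of the partial derivatives of h are the factors in
   Hadamard's lemma. *)
Definition moment (k : nat) h (x : 'rV[R]_n) : R :=
  int01 (fun t => t ^+ k * h (p + t *: (x - p))).


Let B := ball p r.

Lemma ball_segment x t : B x -> 0 <= t <= 1 -> B (p + t *: (x - p)).
Proof.
rewrite /B -ball_normE /= => xp /andP[t0 t1].
rewrite opprD addNKr normrN normrZ ger0_norm // (le_lt_trans _ xp) //.
by rewrite distrC ler_piMl.
Qed.

Lemma moment_cont01 k h x : smooth_on B h -> B x ->
  cont01 (fun t => t ^+ k * h (p + t *: (x - p))).
Proof.
move=> sh Bx t t01; apply: continuousM; first exact: exprn_continuous.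
apply: differentiable_continuous; apply/derivable1_diffP.
have [|+ _] := @is_derive_line R _ _ h p (x - p) t; last by [].
by apply: (smooth_on_differentiable sh); exact: ball_segment.
Qed.

Arguments moment_cont01 k {h x}.

Lemma linear_row_continuous (L : {linear 'rV[R]_n -> R}) : continuous L.
Proof.
have -> : (L : 'rV[R]_n -> R) = fun v => \sum_i coordL i v * L (delta_mx ord0 i).
  apply/funext => v; rewrite {1}(row_sum_coordL v) linear_sum.
  by apply: eq_bigr => i _; rewrite linearZ.
move=> v; apply: differentiable_continuous.
apply: (@smooth_on_differentiable _ _ _ setT) => //.
apply: smooth_on_sum => [|i]; first exact: openT.
apply: smooth_onM; [exact: openT|exact: smooth_on_coordL|exact: smooth_on_cst].
Qed.

Lemma moment_linear k h x : smooth_on B h -> B x ->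
  linear (fun v => moment k (fun y => 'D_v h y) x).
Proof.
move=> sh Bx a v w; have c (u : 'rV[R]_n) := moment_cont01 k (smooth_on_derive u sh) Bx.
rewrite /moment -[a *: int01 _]/(a * int01 _) -int01Z; last exact: c.
rewrite -int01D; [|by apply: cont01Z; exact: c|exact: c].
apply: eq_int01 => t t01.
have dh : differentiable h (p + t *: (x - p)).
  by apply: (smooth_on_differentiable sh); exact: ball_segment.
by rewrite !(deriveE _ dh) linearD linearZ /= scaleRE; ring.
Qed.

Arguments moment_linear k {h x}.

(** Differentiation under the integral sign: moving [x] by [y] moves the argument of [h] by
    [t *: y], which produces one more factor [t]. The Taylor bound is uniform in [t], hence passes
    to the integral. *)
Lemma moment_derive k h x : smooth_on B h -> B x ->
  differentiable (moment k h) x /\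
  forall v, 'D_v (moment k h) x = moment k.+1 (fun y => 'D_v h y) x.
Proof.
move=> sh Bx.
pose LM := GRing.isLinear.Build _ _ _ _ _ (moment_linear k.+1 sh Bx).
pose L : {linear 'rV[R]_n -> R} :=
  HB.pack (fun v => moment k.+1 (fun y => 'D_v h y) x) LM.
have xp : `|x - p| < r by move: (Bx); rewrite /B -ball_normE /= distrC.
(* Half the distance from [x] to the sphere: for increments shorter than [d] all the segments
   involved stay in the closed ball [K] inside [B], and compactness of [K] bounds the second
   derivatives. *)
pose d := (r - `|x - p|) / 2.
have d0 : 0 < d by rewrite divr_gt0 // subr_gt0.
have rd : `|x - p| + d < r by rewrite /d; lra.
pose K := closed_ball p (`|x - p| + d).
have Kd : 0 < `|x - p| + d by rewrite ltr_wpDl.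
have KE z : K z <-> `|z - p| <= `|x - p| + d.
  by rewrite /K closed_ballE // /closed_ball_ /= distrC.
have KB : K `<=` B.
  by move=> z /KE zK; rewrite /B -ball_normE /= distrC (le_lt_trans zK).
have cK : compact K by exact: closed_ball_compact.
have oB : open B by exact: ball_open.
have [C C0 CP] := second_derive_bound oB sh cK KB.
apply: (@differentiable_quadratic _ _ _ x L C d _ d0).
  exact: linear_row_continuous.
move=> y yd; rewrite /= /moment.
have Kxy t s : 0 <= t <= 1 -> 0 <= s <= 1 ->
    K (p + t *: (x - p) + s *: (t *: y)).
  move=> /andP[t0 t1] /andP[s0 s1]; apply/KE.
  rewrite -(addrA p) [p + _]addrC addrK (le_trans (ler_normD _ _)) //.
  rewrite !normrZ !ger0_norm // lerD //; first by rewrite ler_piMl.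
  by rewrite (le_trans _ (ltW yd)) // mulrA ler_piMl // mulr_ile1.
have u01 : 0 <= (1 : R) <= 1 by rewrite ler01 lexx.
have Bxy : B (x + y).
  have := KB _ (Kxy 1 1 u01 u01).
  by rewrite !scale1r (addrC p) subrK.
have sDh : smooth_on B (fun z => 'D_y h z) by exact: smooth_on_derive.
have c1 := moment_cont01 k sh Bxy; have c2 := moment_cont01 k sh Bx.
have c3 := moment_cont01 k.+1 sDh Bx.
have c12 := cont01B c1 c2.
rewrite -int01B // -int01B //.
apply: int01_le; first exact: cont01B.
move=> t /[dup] t01 /andP[t0 t1].
have dh : differentiable h (p + t *: (x - p)).
  by apply: (smooth_on_differentiable sh); exact: ball_segment.
have -> : p + t *: (x + y - p) = p + t *: (x - p) + t *: y.
  by rewrite -(addrA p) -scalerDr addrAC.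
have -> : t ^+ k.+1 * 'D_y h (p + t *: (x - p)) = t ^+ k * 'D_(t *: y) h (p + t *: (x - p)).
  by rewrite !(deriveE _ dh) linearZ exprSr -mulrA.
rewrite -!mulrBr normrM ger0_norm ?exprn_ge0 // (le_trans (ler_piMl _ _)) ?exprn_ile1 //.
apply: (taylor_bound sh) => s s01; first exact/KB/Kxy.
apply: (le_trans (CP _ (t *: y) (Kxy t s t01 s01))).
rewrite ler_wpM2l // ler_pXn2r ?nnegrE // normrZ ger0_norm //.
by rewrite ler_piMl.
Qed.

Arguments moment_derive k {h x}.

(** The weights [t ^+ k] exist for this step: the moments of all orders of all smooth functions form
    a family stable under derivatives. *)
Lemma moment_smooth k h : smooth_on B h -> smooth_on B (moment k h).
Proof.
move=> sh; apply: (@smooth_onP _ _ _ _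
  [set f | exists k h, smooth_on B h /\ f = moment k h]) => [|f x|f v|].
- exact: ball_open.
- by move=> [l [g [sg ->]]] Bx; have [] := moment_derive l sg Bx.
- move=> [l [g [sg ->]]]; exists (moment l.+1 (fun y => 'D_v g y)).
    by exists l.+1, (fun y => 'D_v g y); split=> //; exact: smooth_on_derive.
  by move=> x Bx; have [_] := moment_derive l sg Bx.
- by exists k, h.
Qed.

(** The increment of [h] is the integral of its derivative along the segment from [p] to [x];
    linearity in the direction [x - p] splits this integral into coordinates. *)
Lemma hadamard h : smooth_on B h -> exists g : 'I_n -> 'rV[R]_n -> R,
  [/\ forall i, smooth_on B (g i), forall i, g i p = 'D_(delta_mx ord0 i) h p &
   forall x, B x -> h x = h p + \sum_i (x ord0 i - p ord0 i) * g i x].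
Proof.
move=> sh; exists (fun i => moment 0 (fun y => 'D_(delta_mx ord0 i) h y)); split.
- by move=> i; apply: moment_smooth; exact: smooth_on_derive.
- move=> i; rewrite /moment (@eq_int01 _ _ (cst ('D_(delta_mx ord0 i) h p))).
    exact: int01_cst.
  by move=> t _; rewrite subrr scaler0 addr0 expr0 mul1r.
- move=> x Bx.
  have c0 : cont01 (fun t => 'D_(x - p) h (p + t *: (x - p))).
    rewrite (_ : (fun t => _) = fun t => t ^+ 0 * 'D_(x - p) h (p + t *: (x - p))).
      exact: (moment_cont01 0 (smooth_on_derive (x - p) sh) Bx).
    by apply/funext => t; rewrite expr0 mul1r.
  have E : int01 (fun t => 'D_(x - p) h (p + t *: (x - p))) = h x - h p.
    have dF (t : R) : 0 <= t <= 1 -> is_derive t (1 : R) (fun t => h (p + t *: (x - p)))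
        ('D_(x - p) h (p + t *: (x - p))).
      move=> t01; apply: is_derive_line.
      by apply: (smooth_on_differentiable sh); exact: ball_segment.
    by rewrite (int01_derive c0 dF) scale1r scale0r addr0 (addrC p) subrK.
  rewrite -(subrK (h p) (h x)) -E addrC; congr (_ + _).
  pose LM := GRing.isLinear.Build _ _ _ _ _ (moment_linear 0 sh Bx).
  pose L : {linear 'rV[R]_n -> R} :=
    HB.pack (fun v => moment 0 (fun y => 'D_v h y) x) LM.
  have -> : int01 (fun t => 'D_(x - p) h (p + t *: (x - p))) = L (x - p).
    by apply: eq_int01 => t _; rewrite expr0 mul1r.
  rewrite {1}(row_sum_coordL (x - p)) linear_sum; apply: eq_bigr => i _.
  by rewrite linearZ /= scaleRE /coordL !mxE.
Qed.

End Hadamard.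

(** * Derivations *)

Lemma smooth_on_linear_comp (R : realType) (V W : normedModType R) (A : set V)
    (l : {linear W -> R}) (f : V -> W) :
  open A -> continuous l -> smooth_on A f -> smooth_on A (l \o f).
Proof.
move=> oA cl sf; apply: (@smooth_onP _ _ _ _
  [set g | exists2 f, smooth_on A f & g = l \o f]) => [||g v|]; last by exists f.
- exact: oA.
- move=> _ x [g sg ->] Ax; apply: differentiable_comp.
    exact: (smooth_on_differentiable sg).
  exact: linear_differentiable.
- move=> [{}f {}sf ->]; exists (l \o (fun x => 'D_v f x)).
    by exists (fun x => 'D_v f x) => //; exact: smooth_on_derive.
  move=> x Ax; have df := smooth_on_differentiable sf Ax.
  have dl : differentiable l (f x) by exact: linear_differentiable.
  rewrite deriveE; last exact: differentiable_comp.
  by rewrite (diff_comp df dl) /= (diff_lin _ cl) (deriveE v df).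
Qed.

Section Derivations.
Context {R : realType} (S : Type) (C : set (S -> R)) (p : S).

Definition subalgebra := [/\ forall k : R, C (fun=> k),
  forall f g, C f -> C g -> C (fun x => f x + g x) &
  forall f g, C f -> C g -> C (fun x => f x * g x)].

Hypothesis CA : subalgebra.

Variable v : (S -> R) -> R.
Hypothesis tv : tangent C p v.

Lemma tangent_mul f g : C f -> C g ->
  v (fun x => f x * g x) = f p * v g + g p * v f.
Proof. by case: tv => _ _; apply. Qed.

Lemma tangent_out f : ~ C f -> v f = 0.
Proof. by case: tv => + _ _; apply. Qed.

Lemma tangent_add f g : C f -> C g -> v (fun x => f x + g x) = v f + v g.
Proof.
move=> Cf Cg; have [_ H _] := tv; rewrite -[v f]mul1r -H //.
by congr v; apply/funext => x; rewrite mul1r.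
Qed.

Lemma tangent_cst k : v (fun=> k) = 0.
Proof.
have [Ck _ _] := CA.
have double0 (a : R) : a = a + a -> a = 0.
  by move/eqP; rewrite -subr_eq0 opprD addrA subrr sub0r oppr_eq0 => /eqP.
have v0 : v (fun=> 0) = 0.
  apply: double0; rewrite -tangent_add //.
  by congr v; apply/funext => x; rewrite addr0.
have v1 : v (fun=> 1) = 0.
  apply: double0; rewrite -{2 3}[v _]mul1r -tangent_mul //.
  by congr v; apply/funext => x; rewrite mulr1.
have [_ H _] := tv; have := H k _ _ (Ck 1) (Ck 0).
rewrite v0 v1 mulr0 !addr0 => E; apply: etrans _ E.
by congr v; apply/funext => x; rewrite mulr1.
Qed.

Lemma tangent_sum (I : finType) (f : I -> S -> R) :
  (forall i, C (f i)) -> v (fun x => \sum_i f i x) = \sum_i v (f i).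
Proof.
move=> Cf; have [Ck CD _] := CA.
rewrite (_ : (fun x => _) = \sum_i f i); last first.
  by apply/funext => x; rewrite fct_sumE.
suff [] : C (\sum_i f i) /\ v (\sum_i f i) = \sum_i v (f i) by [].
elim/big_ind2: _ => [|f1 x1 f2 x2 [C1 E1] [C2 E2]|i _].
- by split; [exact: Ck|exact: tangent_cst].
- by split; [exact: CD|rewrite tangent_add // E1 E2].
- by split.
Qed.

End Derivations.

Lemma tangent_linear (R : realType) (S : Type) (C : set (S -> R)) (p : S) a v w :
  tangent C p v -> tangent C p w -> tangent C p (a *: v + w).
Proof.
move=> [v0 vl vm] [w0 wl wm].
have E f : (a *: v + w) f = a * v f + w f by [].
split=> [f Cf|k f g Cf Cg|f g Cf Cg]; rewrite !E.
- by rewrite v0 // w0 // mulr0 addr0.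
- by rewrite vl // wl //; ring.
- by rewrite vm // wm //; ring.
Qed.

Lemma tangent_zero (R : realType) (S : Type) (C : set (S -> R)) (p : S) :
  tangent C p 0.
Proof. have E f : (0 : (S -> R) -> R) f = 0 by [].
by split=> [f _|a f g _ _|f g _ _]; rewrite !E ?mulr0 ?addr0. Qed.

Section TangentClosed.
Context (R : realType) (S : Type) (C : set (S -> R)) (p : S).
Implicit Types v w : (S -> R) -> R.

Lemma tangentD v w : tangent C p v -> tangent C p w -> tangent C p (v + w).
Proof. by move=> tv tw; rewrite -[v]scale1r; exact: tangent_linear. Qed.

Lemma tangentZ a v : tangent C p v -> tangent C p (a *: v).
Proof. by move=> tv; rewrite -[_ *: _]addr0; apply: tangent_linear => //; exact: tangent_zero. Qed.

Lemma tangentN v : tangent C p v -> tangent C p (- v).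
Proof. by move=> tv; rewrite -scaleN1r; exact: tangentZ. Qed.

Lemma tangentB v w : tangent C p v -> tangent C p w -> tangent C p (v - w).
Proof. by move=> tv tw; apply: tangentD => //; exact: tangentN. Qed.

End TangentClosed.

(** * Tangent vectors in a chart *)

Section Manifold.
Context {R : realType} {n : nat} (M : manifold R n).
Implicit Types (c d : chart R n M) (x : M) (a b : 'rV[R]_n).

Section Chart.
Variable c : chart R n M.
Hypothesis ac : atlas c.

Lemma open_chart_dom : open (chart_dom c).
Proof. by have [[]] := atlas_chart ac. Qed.

Lemma open_chart_cod : open (chart_cod c).
Proof. by have [[]] := atlas_chart ac. Qed.

Lemma chart_mapK x : chart_dom c x -> chart_inv c (chart_map c x) = x.
Proof. by have [_ + _ _] := atlas_chart ac; apply. Qed.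

Lemma chart_map_cod x : chart_dom c x -> chart_cod c (chart_map c x).
Proof. by move=> cx; exists x. Qed.

Lemma chart_inv_dom a : chart_cod c a -> chart_dom c (chart_inv c a).
Proof. by move=> [x cx <-]; rewrite chart_mapK. Qed.

Lemma chart_invK a : chart_cod c a -> chart_map c (chart_inv c a) = a.
Proof. by move=> [x cx <-]; rewrite chart_mapK. Qed.

Lemma chart_map_continuous x : chart_dom c x -> {for x, continuous (chart_map c)}.
Proof.
move=> cx; have [_ _ + _] := atlas_chart ac.
rewrite continuous_open_subspace; last exact: open_chart_dom.
by move/(_ x); apply; rewrite inE.
Qed.

Lemma chart_inv_continuous a : chart_cod c a -> {for a, continuous (chart_inv c)}.
Proof.
move=> ca; have [_ _ _] := atlas_chart ac.
rewrite continuous_open_subspace; last exact: open_chart_cod.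
by move/(_ a); apply; rewrite inE.
Qed.

Lemma open_chart_map_preimage (U : set 'rV[R]_n) : open U ->
  open [set x | chart_dom c x /\ U (chart_map c x)].
Proof.
move=> oU; rewrite openE => x [cx Ux]; apply: filterI.
  by apply: open_nbhs_nbhs; split=> //; exact: open_chart_dom.
by apply: chart_map_continuous => //; apply: open_nbhs_nbhs.
Qed.

Lemma open_chart_inv_preimage (U : set M) : open U ->
  open [set a | chart_cod c a /\ U (chart_inv c a)].
Proof.
move=> oU; rewrite openE => a [ca Ua]; apply: filterI.
  by apply: open_nbhs_nbhs; split=> //; exact: open_chart_cod.
by apply: chart_inv_continuous => //; apply: open_nbhs_nbhs.
Qed.

End Chart.

Lemma smoothM_subalgebra : subalgebra (@smoothM R n M).
Proof.
split=> [k c ac|f g sf sg c ac|f g sf sg c ac].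
- exact: smooth_on_cst.
- by apply: smooth_onD; [exact: open_chart_cod|exact: sf|exact: sg].
- by apply: smooth_onM; [exact: open_chart_cod|exact: sf|exact: sg].
Qed.

Definition chart_extend c (h : 'rV[R]_n -> R) : M -> R := fun x =>
  if `[< chart_dom c x >] then h (chart_map c x) else 0.

Lemma chart_extendE c h a : atlas c -> chart_cod c a ->
  chart_extend c h (chart_inv c a) = h a.
Proof.
move=> ac ca; rewrite /chart_extend; case: asboolP => [_|].
  by rewrite chart_invK.
by move=> /(_ (chart_inv_dom ac ca)).
Qed.

(** The image [K] of the closed ball of radius [s] is compact, hence closed because the manifold is
    Hausdorff. Off [K] the extension is 0; on the chart image of the larger ball it is [h] composed
    with a smooth change of charts. These two open sets cover the manifold. *)
Lemma smoothM_chart_extend c p (r s : R) (h : 'rV[R]_n -> R) :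
  atlas c -> 0 < s -> s < r -> ball p r `<=` chart_cod c ->
  smooth_on (ball p r) h -> (forall a, s <= `|a - p| -> h a = 0) ->
  smoothM (chart_extend c h).
Proof.
move=> ac s0 sr pc sh h0 d ad.
pose K := chart_inv c @` closed_ball p s.
have sK a : closed_ball p s a <-> `|a - p| <= s.
  by rewrite closed_ballE // /closed_ball_ /= distrC.
have KB : closed_ball p s `<=` ball p r.
  by move=> a /sK aK; rewrite -ball_normE /= distrC (le_lt_trans aK).
have cK : compact K.
  apply: continuous_compact.
    apply/subspace_continuousP => a /KB/pc ca; apply: cvg_within_filter.
    exact: chart_inv_continuous.
  exact: closed_ball_compact.
have oKC : open (~` K).
  by apply: closed_openC; apply: compact_closed cK; exact: manifold_hausdorff.
apply: smooth_on_local => b db.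
have [[cb pb]|Kb] := pselect (chart_dom c (chart_inv d b) /\
    ball p r (chart_map c (chart_inv d b))).
- exists [set b' | chart_cod d b' /\ [set x | chart_dom c x /\
    ball p r (chart_map c x)] (chart_inv d b')], (h \o (chart_map c \o chart_inv d)).
  have oU : open [set b' | chart_cod d b' /\ [set x | chart_dom c x /\
      ball p r (chart_map c x)] (chart_inv d b')].
    apply: open_chart_inv_preimage => //; apply: open_chart_map_preimage => //.
    exact: ball_open.
  split => //; last first.
    by move=> b' [_ [cb' _]]; rewrite /= /chart_extend; case: asboolP.
  have stau : smooth_on [set b' | chart_cod d b' /\ [set x | chart_dom c x /\
    ball p r (chart_map c x)] (chart_inv d b')] (chart_map c \o chart_inv d).
    apply: smooth_onW (atlas_smooth ad ac) => b' [db' [cb' _]].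
    exists (chart_inv d b'); last exact: chart_invK.
    by split=> //; exact: chart_inv_dom.
  apply: (smooth_on_comp_row oU _ _ _ sh).
  + by move=> b' [_ [_]].
  + by move=> b'; exact: smooth_on_differentiable.
  + by move=> i; apply: smooth_on_linear_comp => //; exact: coordL_continuous.
- exists [set b' | chart_cod d b' /\ (~` K) (chart_inv d b')], (cst 0); split.
  + exact: open_chart_inv_preimage.
  + split=> // -[a aK E]; apply: Kb; rewrite -E; have ca := pc _ (KB _ aK).
    by split; [exact: chart_inv_dom|rewrite chart_invK //; exact: KB].
  + exact: smooth_on_cst.
  + move=> b' [db' Kb']; rewrite /= /chart_extend; case: asboolP => // cb'.
    apply: h0; rewrite leNgt; apply/negP => /ltW ba; apply: Kb'.
    by exists (chart_map c (chart_inv d b')); [exact/sK|rewrite chart_mapK].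
Qed.

Definition tvec c a b : (M -> R) -> R := (TM_chart_inv c (a, b)).2.

Lemma tvecE c a b f : smoothM f -> tvec c a b f = 'D_b (f \o chart_inv c) a.
Proof. by rewrite /tvec /TM_chart_inv /=; case: asboolP. Qed.

Lemma tvec_out c a b f : ~ smoothM f -> tvec c a b f = 0.
Proof. by rewrite /tvec /TM_chart_inv /=; case: asboolP. Qed.

Section TangentChart.
Variable c : chart R n M.
Hypothesis ac : atlas c.

Lemma smoothM_differentiable f a : smoothM f -> chart_cod c a ->
  differentiable (f \o chart_inv c) a.
Proof. by move=> sf ca; exact: (smooth_on_differentiable (sf c ac)). Qed.

Lemma tvec_tangent a b : chart_cod c a -> tangent smoothM (chart_inv c a) (tvec c a b).
Proof.
move=> ca; have [Ck CD CM] := smoothM_subalgebra; split.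
- by move=> f; exact: tvec_out.
- move=> k f g sf sg; rewrite !tvecE //; last by apply: CD => //; exact: CM.
  have df := @diff_derivable _ _ _ _ _ b (smoothM_differentiable sf ca).
  have dg := @diff_derivable _ _ _ _ _ b (smoothM_differentiable sg ca).
  rewrite -[LHS]/('D_b (k \*: (f \o chart_inv c) + (g \o chart_inv c)) a).
  by rewrite (deriveD (derivableZ (k := k) df) dg) (deriveZ k df).
- move=> f g sf sg; rewrite !tvecE //; last exact: CM.
  have df := @diff_derivable _ _ _ _ _ b (smoothM_differentiable sf ca).
  have dg := @diff_derivable _ _ _ _ _ b (smoothM_differentiable sg ca).
  rewrite -[LHS]/('D_b ((f \o chart_inv c) * (g \o chart_inv c)) a).
  exact: deriveM df dg.
Qed.

Lemma tvec_linear a k b b' : chart_cod c a ->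
  tvec c a (k *: b + b') = k *: tvec c a b + tvec c a b'.
Proof.
move=> ca; apply/funext => f.
rewrite -[RHS]/(k * tvec c a b f + tvec c a b' f).
have [sf|sf] := pselect (smoothM f); last by rewrite !tvec_out // mulr0 addr0.
have df := smoothM_differentiable sf ca.
by rewrite !tvecE // !(deriveE _ df) linearD linearZ.
Qed.

Lemma tvec0 a : tvec c a 0 = 0.
Proof.
apply/funext => f; rewrite -[RHS]/(0 : R).
have [sf|sf] := pselect (smoothM f); last by rewrite tvec_out.
by rewrite tvecE // derive0.
Qed.

Section Bump.
Variable p : 'rV[R]_n.
Hypothesis cp : chart_cod c p.

(** Localization: every function smooth near [p] agrees on the neighbourhood [O] with a smooth
    function on the whole manifold, to which a derivation can be applied. *)
Lemma chart_cutoff : exists r (chi : 'rV[R]_n -> R) O, [/\ 0 < r,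
  ball p r `<=` chart_cod c,
  forall h, smooth_on (ball p r) h -> smoothM (chart_extend c (fun a => chi a * h a)),
  [/\ open O, O p & O `<=` ball p r] &
  (forall a, O a -> chi a = 1) /\ (forall a, ~ ball p r a -> chi a = 0)].
Proof.
have /nbhs_ballP [r r0 rc] : nbhs p (chart_cod c).
  by apply: open_nbhs_nbhs; split=> //; exact: open_chart_cod.
have s0 : 0 < r / 2 by rewrite divr_gt0.
have [chi [schi chi0 chi1]] := smooth_bump p s0.
exists r, chi, (ball p r `&` interior [set a | chi a = 1]); split => //.
- move=> h sh; apply: (@smoothM_chart_extend _ p r (r / 2)) => //.
  + by rewrite ltr_pdivrMr // ltr_pMr // ltr1n.
  + apply: smooth_onM => //; first exact: ball_open.
    exact: smooth_onW schi.
  + by move=> a ra; rewrite chi0 // mul0r.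
- split; first by apply: openI; [exact: ball_open|exact: open_interior].
    by split; [exact: ballxx|exact: chi1].
  by move=> a [].
- split=> [a [_ /interior_subset]//|a na]; apply: chi0.
  rewrite leNgt; apply/negP => ar; apply: na; rewrite -ball_normE /= distrC.
  by rewrite (lt_trans ar) // ltr_pdivrMr // ltr_pMr // ltr1n.
Qed.

(** Global smooth functions that read off the components of tangent vectors at all points of a
    neighbourhood, not only at [p]. This turns smoothness of a field into smoothness of its
    components. *)
Lemma chart_coordinates : exists U (xi : 'I_n -> M -> R),
  [/\ open U, U p, U `<=` chart_cod c, forall i, smoothM (xi i) &
   forall a b i, U a -> tvec c a b (xi i) = b ord0 i].
Proof.
have [r [chi [U [r0 rc ext [oU Up Ur] [chi1 chi0]]]]] := chart_cutoff.
exists U, (fun i => chart_extend c (fun a => chi a * coordL i a)).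
have sx i : smoothM (chart_extend c (fun a => chi a * coordL i a)).
  by apply: ext; exact: smooth_on_coordL.
split => // [|a b i Ua]; first exact: subset_trans rc.
rewrite tvecE //; transitivity ('D_b (coordL i) a).
  apply: near_eq_derive; near=> a'.
  have Ua' : U a' by near: a'; exact: open_nbhs_nbhs.
  by rewrite /= chart_extendE // ?chi1 ?mul1r //; exact/rc/Ur.
have cl := @coordL_continuous R n i.
by rewrite deriveE ?(diff_lin _ cl) //; exact: linear_differentiable.
Unshelve. all: by end_near. Qed.

Lemma tvec_inj b b' : tvec c p b = tvec c p b' -> b = b'.
Proof.
have [U [xi [_ Up _ sxi xiE]]] := chart_coordinates.
by move=> E; apply/rowP => i; rewrite -(xiE p) // E xiE.
Qed.

(** The components of [v] are its values on the cut-off coordinates. Hadamard's lemma writes [f]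
    minus its value at the point as a sum of products, where the first factors vanish at the point,
    so the Leibniz rule leaves only the partial derivatives. *)
Lemma tangent_tvec v : tangent smoothM (chart_inv c p) v -> exists b, v = tvec c p b.
Proof.
move=> tv; have CA := smoothM_subalgebra; have [Ck CD CM] := CA.
have [r [chi [U [r0 rc ext [oU Up Ur] [chi1 chi0]]]]] := chart_cutoff.
pose xi i := chart_extend c (fun a => chi a * (coordL i a - coordL i p)).
have sxi i : smoothM (xi i).
  apply: ext; apply: smooth_onB; [exact: ball_open|exact: smooth_on_coordL|].
  exact: smooth_on_cst.
pose phi := chart_extend c (fun a => chi a * 1).
have sphi : smoothM phi by apply: ext; exact: smooth_on_cst.
exists (\row_i v (xi i)); apply/funext => f.
have [sf|sf] := pselect (smoothM f); last first.
  by rewrite (tangent_out tv) // tvec_out.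
rewrite tvecE //.
have sfc : smooth_on (ball p r) (f \o chart_inv c) by apply: smooth_onW (sf c ac).
have [g [sg gp gE]] := hadamard sfc.
pose gam i := chart_extend c (fun a => chi a * g i a).
have sgam i : smoothM (gam i) by apply: ext; exact: sg.
(* The Hadamard identity holds on the ball only. It is multiplied by the square of the cutoff: one
   factor makes the coordinate global, the other the Hadamard factor. The left side has the same
   derivative as [f], as [phi] is 1 and the bracket is 0 at the point. *)
have E : (fun x => (phi x * phi x) * (f x - f (chart_inv c p))) =
    (fun x => \sum_i xi i x * gam i x).
  apply/funext => x; rewrite /phi /xi /gam /chart_extend; case: asboolP => cx; last first.
    by rewrite !mul0r big1 // => i _; rewrite mul0r.
  have [bx|bx] := pselect (ball p r (chart_map c x)); last first.
    by rewrite chi0 // !mul0r big1 // => i _; rewrite !mul0r.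
  have := gE _ bx; rewrite /= chart_mapK // => ->.
  rewrite addrAC subrr add0r mulr_sumr; apply: eq_bigr => i _.
  by rewrite /coordL; ring.
have phip : phi (chart_inv c p) = 1 by rewrite /phi chart_extendE // chi1 ?mulr1.
have xip i : xi i (chart_inv c p) = 0 by rewrite /xi chart_extendE // subrr mulr0.
have gamp i : gam i (chart_inv c p) = g i p.
  by rewrite /gam chart_extendE // chi1 // mul1r.
have sfp : smoothM (fun x => f x - f (chart_inv c p)) by apply: CD => //; exact: Ck.
have /(congr1 v) := E.
rewrite (tangent_mul tv (CM _ _ sphi sphi) sfp) subrr mul0r addr0 phip !mul1r.
rewrite (tangent_add tv sf (Ck _)) (tangent_cst CA tv) addr0 => ->.
rewrite (tangent_sum CA tv) => [|i]; last exact: CM.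
rewrite derive_row_sum; last exact: smoothM_differentiable.
apply: eq_bigr => i _; rewrite (tangent_mul tv) // xip mul0r add0r gamp gp.
by rewrite mulrC /coordL mxE.
Qed.

End Bump.
End TangentChart.
End Manifold.

(** * The slit tangent bundle *)

Section Product.
Context {R : realType} {V W : normedModType R}.

Lemma fst_continuous : continuous (@fst V W).
Proof. by move=> x; exact: cvg_fst. Qed.

Lemma snd_continuous : continuous (@snd V W).
Proof. by move=> x; exact: cvg_snd. Qed.

Lemma smooth_on_fst (A : set (V * W)) : smooth_on A (@fst V W).
Proof. by apply: smooth_on_linear; exact: fst_continuous. Qed.

Lemma smooth_on_snd (A : set (V * W)) : smooth_on A (@snd V W).
Proof. by apply: smooth_on_linear; exact: snd_continuous. Qed.

End Product.

Section Slit.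
Context {R : realType} {n : nat} (M : manifold R n).
Implicit Types (c d : chart R n M) (x : M) (a b y z : 'rV[R]_n) (u : slit M).

Definition slit_coord c : set ('rV[R]_n * 'rV[R]_n) :=
  [set ab | chart_cod c ab.1 /\ ab.2 <> 0].

Lemma open_slit_coord c : atlas c -> open (slit_coord c).
Proof.
move=> ac; rewrite (_ : slit_coord c =
  (fst @^-1` chart_cod c) `&` (snd @^-1` ~` [set 0])); last by [].
apply: openI; apply: open_comp.
- by move=> x _; exact: fst_continuous.
- exact: open_chart_cod.
- by move=> x _; exact: snd_continuous.
- by apply: closed_openC; apply: compact_closed (@compact_set1 _ _); exact: norm_hausdorff.
Qed.

Lemma slit_ofP w : slit_set w -> exists u : slit M, val u = w.
Proof. by move=> sw; exists (exist _ w (mem_set sw)). Qed.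

Lemma slitP c ab : atlas c -> slit_coord c ab ->
  exists u : slit M, val u = TM_chart_inv c ab.
Proof.
case: ab => a b ac [/= ca b0]; apply: slit_ofP; split.
  exact: tvec_tangent.
by rewrite -[X in X <> _]/(tvec c a b) -(tvec0 c a) => /(tvec_inj ac ca).
Qed.

Lemma slit_tangent u : tangent smoothM (base u) (vec u).
Proof. by have /set_mem [] := valP u. Qed.

Lemma slit_coordinates c u : atlas c -> chart_dom c (base u) ->
  exists2 ab, slit_coord c ab & val u = TM_chart_inv c ab.
Proof.
move=> ac cu; have /set_mem [_ u0] := valP u.
have ca := chart_map_cod cu.
have [|b ub] := @tangent_tvec _ _ _ _ ac _ ca (vec u).
  by rewrite chart_mapK //; exact: slit_tangent.
exists (chart_map c (base u), b).
  by split=> [|/= b0] //; apply: u0; rewrite -/(vec u) ub b0 tvec0.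
rewrite (surjective_pairing (val u)) -/(vec u) ub -/(base u).
by rewrite /tvec /TM_chart_inv /= (chart_mapK ac cu).
Qed.

Lemma slit_chart u : exists c ab, [/\ atlas c, slit_coord c ab & val u = TM_chart_inv c ab].
Proof.
have [c ac cu] := atlas_cover (base u).
by have [ab] := slit_coordinates ac cu; exists c, ab.
Qed.

Lemma extend0_val (F : slit M -> R) u : extend0 F (val u) = F u.
Proof. by rewrite /extend0 valK. Qed.

Lemma smoothTM_subalgebra : subalgebra (@smoothTM R n M).
Proof.
split=> [k c ac|F G sF sG c ac|F G sF sG c ac].
- apply: (eq_smooth_on (open_slit_coord ac) (g := cst k)) => [ab sab|]; last first.
    exact: smooth_on_cst.
  by have [u uE] := slitP ac sab; rewrite /= -uE extend0_val.
- have := smooth_onD (open_slit_coord ac) (sF c ac) (sG c ac).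
  apply: (eq_smooth_on (open_slit_coord ac)) => ab sab.
  by have [u uE] := slitP ac sab; rewrite /= -uE !extend0_val.
- have := smooth_onM (open_slit_coord ac) (sF c ac) (sG c ac).
  apply: (eq_smooth_on (open_slit_coord ac)) => ab sab.
  by have [u uE] := slitP ac sab; rewrite /= -uE !extend0_val.
Qed.

Lemma smooth_on_fst_comp (A : set ('rV[R]_n * 'rV[R]_n)) (B : set 'rV[R]_n)
    (f : 'rV[R]_n -> R) : open A -> (forall ab, A ab -> B ab.1) ->
  smooth_on B f -> smooth_on A (fun ab => f ab.1).
Proof.
move=> oA AB sf; apply: (smooth_on_comp_row oA (tau := fst)) sf => //.
- move=> x Ax; apply: smooth_on_differentiable Ax; exact: smooth_on_fst.
- move=> i; apply: smooth_on_linear_comp => //; first exact: coordL_continuous.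
  exact: smooth_on_fst.
Qed.

Lemma base_smooth (f : M -> R) : smoothM f -> smoothTM (fun u => f (base u)).
Proof.
move=> sf c ac; have oA := open_slit_coord ac.
have := smooth_on_fst_comp oA (fun ab (h : slit_coord c ab) => h.1) (sf c ac).
apply: (eq_smooth_on oA) => ab sab.
by have [u uE] := slitP ac sab; rewrite /= -uE extend0_val /base uE.
Qed.

Lemma vec_pi_field : pi_field (@vec R n M).
Proof.
split=> [|f sf c ac]; first exact: slit_tangent.
have oA := open_slit_coord ac.
pose g i a := 'D_(delta_mx ord0 i) (f \o chart_inv c) a.
apply: (eq_smooth_on oA (g := fun ab => \sum_i coordL i ab.2 * g i ab.1)).
  move=> ab sab; have [u uE] := slitP ac sab; rewrite /= -uE extend0_val /vec uE.
  rewrite -[LHS]/(tvec c ab.1 ab.2 f) tvecE // derive_row_sum //.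
  by apply: smoothM_differentiable => //; exact: sab.1.
apply: smooth_on_sum => // i; apply: smooth_onM => //.
  apply: (smooth_on_linear_comp (l := coordL i)) => //; first exact: coordL_continuous.
  exact: smooth_on_snd.
apply: (@smooth_on_fst_comp _ (chart_cod c)) => //; first by move=> ab [].
by apply: smooth_on_derive; exact: sf.
Qed.

End Slit.

(** * Coordinate vectors on the slit bundle, the vertical lift and the projection *)

Section Slit.
Context {R : realType} {n : nat} (M : manifold R n).
Implicit Types (c d : chart R n M) (x : (M -> R) -> R) (a b y z : 'rV[R]_n) (u : slit M).
Implicit Types (ab xy : 'rV[R]_n * 'rV[R]_n).

Notation in_chart c F := (extend0 F \o TM_chart_inv c).

Lemma smoothTM_differentiable c F ab : atlas c -> slit_coord c ab -> smoothTM F ->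
  differentiable (in_chart c F) ab.
Proof. by move=> ac sab sF; exact: (smooth_on_differentiable (sF c ac)). Qed.

(** The analogue of [tvec] on the slit bundle: [xy.1] holds the base components and [xy.2] the fibre
    components. *)
Definition chart_derivation c ab xy : (slit M -> R) -> R := fun F =>
  if `[< smoothTM F >] then 'D_xy (in_chart c F) ab else 0.

Lemma chart_derivationE c ab xy F : smoothTM F ->
  chart_derivation c ab xy F = 'D_xy (in_chart c F) ab.
Proof. by move=> sF; rewrite /chart_derivation; case: asboolP. Qed.

Lemma chart_derivation_out c ab xy F : ~ smoothTM F -> chart_derivation c ab xy F = 0.
Proof. by move=> sF; rewrite /chart_derivation; case: asboolP. Qed.

Lemma near_slit_coord c ab : atlas c -> slit_coord c ab -> \near ab, slit_coord c ab.
Proof. by move=> ac sab; apply: open_nbhs_nbhs; split=> //; exact: open_slit_coord. Qed.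

Lemma chart_derivation_tangent c ab xy u : atlas c -> slit_coord c ab ->
  val u = TM_chart_inv c ab -> tangent smoothTM u (chart_derivation c ab xy).
Proof.
move=> ac sab uE; have [Ck CD CM] := smoothTM_subalgebra M.
have nsab := near_slit_coord ac sab.
split=> [F|k F G sF sG|F G sF sG]; first exact: chart_derivation_out.
- rewrite !chart_derivationE //; last by apply: CD => //; exact: CM.
  have dF := @diff_derivable _ _ _ _ _ xy (smoothTM_differentiable ac sab sF).
  have dG := @diff_derivable _ _ _ _ _ xy (smoothTM_differentiable ac sab sG).
  transitivity ('D_xy (k \*: in_chart c F + in_chart c G) ab).
    apply: near_eq_derive; near=> cd.
    have [|v vE] := @slitP _ _ _ c cd ac; first by near: cd.
    by rewrite -[RHS]/(k * in_chart c F cd + in_chart c G cd) /= -vE !extend0_val.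
  by rewrite (deriveD (derivableZ (k := k) dF) dG) (deriveZ k dF).
- rewrite !chart_derivationE //; last exact: CM.
  have dF := @diff_derivable _ _ _ _ _ xy (smoothTM_differentiable ac sab sF).
  have dG := @diff_derivable _ _ _ _ _ xy (smoothTM_differentiable ac sab sG).
  transitivity ('D_xy (in_chart c F * in_chart c G) ab).
    apply: near_eq_derive; near=> cd.
    have [|v vE] := @slitP _ _ _ c cd ac; first by near: cd.
    by rewrite -[RHS]/(in_chart c F cd * in_chart c G cd) /= -vE !extend0_val.
  by rewrite (deriveM dF dG) /= -uE !extend0_val.
Unshelve. all: by end_near. Qed.

Lemma TM_chart_inv_line c ab y (t : R) : atlas c -> chart_cod c ab.1 ->
  TM_chart_inv c (ab + t *: (0, y)) =
  (chart_inv c ab.1, tvec c ab.1 ab.2 + t *: tvec c ab.1 y).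
Proof.
move=> ac ca.
have -> : tvec c ab.1 ab.2 + t *: tvec c ab.1 y = tvec c ab.1 (t *: y + ab.2).
  by rewrite tvec_linear // addrC.
by rewrite (surjective_pairing (ab + _)) /= scaler0 addr0 addrC.
Qed.

Lemma gamma_chart c ab y u : atlas c -> slit_coord c ab ->
  val u = TM_chart_inv c ab ->
  gamma u (tvec c ab.1 y) = chart_derivation c ab (0, y).
Proof.
move=> ac sab uE; apply/funext => F.
have [sF|sF] := pselect (smoothTM F); last first.
  by rewrite chart_derivation_out // /gamma; case: asboolP.
rewrite chart_derivationE // /gamma; case: asboolP => // _.
have -> : (fun t : R => extend0 F (base u, vec u + t *: tvec c ab.1 y)) =
    (fun t : R => in_chart c F (ab + t *: (0, y))).
  apply/funext => t; rewrite /= TM_chart_inv_line //; last exact: sab.1.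
  by rewrite /base /vec uE.
have ab0 : ab + (0 : R) *: (0, y) = ab by rewrite scale0r addr0.
have d0 : differentiable (in_chart c F) (ab + (0 : R) *: (0, y)).
  by rewrite ab0; exact: smoothTM_differentiable.
by rewrite derive1E; have [_ ->] := is_derive_line d0; rewrite ab0.
Qed.

Lemma tangent_slit u x : tangent smoothM (base u) x ->
  exists c ab y, [/\ atlas c, slit_coord c ab, val u = TM_chart_inv c ab & x = tvec c ab.1 y].
Proof.
have [c [ab [ac sab uE]]] := slit_chart u; rewrite /base uE => tx.
by have [y yE] := tangent_tvec ac sab.1 tx; exists c, ab, y.
Qed.

Lemma gamma_tangent u x : tangent smoothM (base u) x -> tangent smoothTM u (gamma u x).
Proof.
move=> /tangent_slit [c [ab [y [ac sab uE ->]]]]; rewrite (gamma_chart y ac sab uE).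
exact: chart_derivation_tangent.
Qed.

Lemma tvec_tangentE c ab u y : atlas c -> slit_coord c ab -> val u = TM_chart_inv c ab ->
  tangent smoothM (base u) (tvec c ab.1 y).
Proof. by move=> ac sab uE; rewrite /base uE; apply: (tvec_tangent ac); exact: sab.1. Qed.

Lemma gamma_linear u k x x' : tangent smoothM (base u) x -> tangent smoothM (base u) x' ->
  gamma u (k *: x + x') = k *: gamma u x + gamma u x'.
Proof.
have [c [ab [ac sab uE]]] := slit_chart u; rewrite /base uE => tx tx'.
have [y ->] := tangent_tvec ac sab.1 tx; have [y' ->] := tangent_tvec ac sab.1 tx'.
rewrite -tvec_linear //; last exact: sab.1.
rewrite !(gamma_chart _ ac sab uE); apply/funext => F.
rewrite -[RHS]/(k * chart_derivation c ab (0, y) F + chart_derivation c ab (0, y') F).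
have [sF|sF] := pselect (smoothTM F); last first.
  by rewrite !chart_derivation_out // mulr0 addr0.
have dF := smoothTM_differentiable ac sab sF.
rewrite !chart_derivationE // !(deriveE _ dF).
rewrite (_ : (0, k *: y + y') = k *: ((0, y) : 'rV[R]_n * 'rV[R]_n) + (0, y')).
  by rewrite linearD linearZ.
by congr (_, _); rewrite /= scaler0 addr0.
Qed.

Lemma chart_derivation_base c ab xy (f : M -> R) : atlas c -> slit_coord c ab -> smoothM f ->
  'D_xy (in_chart c (fun q => f (base q))) ab = tvec c ab.1 xy.1 f.
Proof.
move=> ac sab sf; have nsab := near_slit_coord ac sab.
transitivity ('D_xy ((f \o chart_inv c) \o fst) ab).
  apply: near_eq_derive; near=> cd.
  have [|v vE] := @slitP _ _ _ c cd ac; first by near: cd.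
  by rewrite /= -vE extend0_val /base vE.
have df : differentiable (f \o chart_inv c) ab.1 by exact: smoothM_differentiable sab.1.
have cf := @fst_continuous R 'rV[R]_n 'rV[R]_n.
have d1 : differentiable (@fst 'rV[R]_n 'rV[R]_n) ab by exact: linear_differentiable.
rewrite deriveE; last exact: differentiable_comp.
by rewrite (diff_comp d1 df) /= (diff_lin _ cf) tvecE // (deriveE _ df).
Unshelve. all: by end_near. Qed.

Lemma gamma_base u x (f : M -> R) : tangent smoothM (base u) x -> smoothM f ->
  gamma u x (fun q => f (base q)) = 0.
Proof.
move=> /tangent_slit [c [ab [y [ac sab uE ->]]]] sf.
rewrite (gamma_chart y ac sab uE) chart_derivationE ?chart_derivation_base //.
  by rewrite tvec0.
exact: base_smooth.
Qed.

Lemma rhoE u w f : smoothM f -> rho u w f = w (fun q => f (base q)).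
Proof. by move=> sf; rewrite /rho; case: asboolP. Qed.

Lemma rho_out u w f : ~ smoothM f -> rho u w f = 0.
Proof. by move=> sf; rewrite /rho; case: asboolP. Qed.

Lemma rho_linear u k w w' : rho u (k *: w + w') = k *: rho u w + rho u w'.
Proof.
apply/funext => f; rewrite -[RHS]/(k * rho u w f + rho u w' f).
have [sf|sf] := pselect (smoothM f); first by rewrite !rhoE.
by rewrite !rho_out // mulr0 addr0.
Qed.

Lemma rho_tangent u w : tangent smoothTM u w -> tangent smoothM (base u) (rho u w).
Proof.
move=> [w0 wl wm]; have [Ck CD CM] := smoothM_subalgebra M; split=> [f|k f g sf sg|f g sf sg].
- exact: rho_out.
- rewrite !rhoE //; last by apply: CD => //; exact: CM.
  by apply: wl; exact: base_smooth.
- rewrite !rhoE //; last exact: CM.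
  by apply: wm; exact: base_smooth.
Qed.

Lemma rho_gamma u x : tangent smoothM (base u) x -> rho u (gamma u x) = 0.
Proof.
move=> tx; apply/funext => f; rewrite -[RHS]/(0 : R).
by have [sf|sf] := pselect (smoothM f); [rewrite rhoE // gamma_base|rewrite rho_out].
Qed.

Lemma rho_surjective u x : tangent smoothM (base u) x ->
  exists2 w, tangent smoothTM u w & rho u w = x.
Proof.
move=> /tangent_slit [c [ab [y [ac sab uE ->]]]].
exists (chart_derivation c ab (y, 0)); first exact: chart_derivation_tangent.
apply/funext => f; have [sf|sf] := pselect (smoothM f); last first.
  by rewrite rho_out // tvec_out.
rewrite rhoE // chart_derivationE ?chart_derivation_base //.
exact: base_smooth.
Qed.

End Slit.

(** * The Finsler metric *)

Section Metric.
Context {R : realType} {n : nat} (M : manifold R n).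
Implicit Types (c d : chart R n M) (x : (M -> R) -> R) (a b y z : 'rV[R]_n) (u : slit M).
Implicit Types (ab xy : 'rV[R]_n * 'rV[R]_n).

(** The extension is constant along the fibres, being pulled back from a vector field on the
    manifold. Thus its vertical derivative vanishes, which is the use of the last clause. *)
Lemma pi_field_extension u x : tangent smoothM (base u) x ->
  exists zeta : M -> (M -> R) -> R, [/\ pi_field (fun q : slit M => zeta (base q)),
    zeta (base u) = x & forall f, smoothM f -> smoothM (fun m => zeta m f)].
Proof.
move=> tx; have := tx; move=> /tangent_slit [c [ab [y [ac sab uE xE]]]].
have [r [chi [U [r0 rc ext [oU Up Ur] [chi1 chi0]]]]] := chart_cutoff ac sab.1.
(* Constant components in the chart, multiplied by the cutoff. *)
pose zeta (m : M) : (M -> R) -> R := if `[< chart_dom c m >] then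
  chi (chart_map c m) *: tvec c (chart_map c m) y else 0.
have sz f : smoothM f -> smoothM (fun m => zeta m f).
  move=> sf; rewrite (_ : (fun m => _) =
      chart_extend c (fun a => chi a * 'D_y (f \o chart_inv c) a)).
    by apply: ext; apply: smooth_on_derive; exact: smooth_onW (sf c ac).
  apply/funext => m; rewrite /zeta /chart_extend; case: asboolP => // cm.
  rewrite -[LHS]/(chi (chart_map c m) * tvec c (chart_map c m) y f).
  by rewrite tvecE.
have tz m : tangent smoothM m (zeta m).
  rewrite /zeta; case: asboolP => cm; last exact: tangent_zero.
  apply: tangentZ; have := tvec_tangent ac y (chart_map_cod cm).
  by rewrite chart_mapK.
exists zeta; split => //.
- split=> [u'|f sf]; first exact: tz.
  exact: (base_smooth (sz f sf)).
- have bu : base u = chart_inv c ab.1 by rewrite /base uE.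
  have cu : chart_dom c (base u) by rewrite bu; apply: chart_inv_dom => //; exact: sab.1.
  rewrite /zeta; case: asboolP => // _.
  by rewrite bu chart_invK ?chi1 ?scale1r //; exact: sab.1.
Qed.

Variable L : TM M -> R.
Hypothesis sL : smoothTM (fun u : slit M => L (val u)).

Definition energy c ab : R := L (TM_chart_inv c ab) ^+ 2 / 2.

Lemma energy_smooth c : atlas c -> smooth_on (slit_coord c) (energy c).
Proof.
move=> ac; have oA := open_slit_coord ac.
apply: smooth_onM => //; last exact: smooth_on_cst.
apply: smooth_onX => //; have := sL ac.
apply: (eq_smooth_on oA) => ab sab.
by have [u uE] := slitP ac sab; rewrite /= -uE extend0_val.
Qed.

Lemma metric_chart c ab y z u : atlas c -> slit_coord c ab -> val u = TM_chart_inv c ab ->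
  finsler_metric L u (tvec c ab.1 y) (tvec c ab.1 z) =
  'D_(0, y) (fun cd => 'D_(0, z) (energy c) cd) ab.
Proof.
move=> ac sab uE; rewrite /finsler_metric.
have sE := energy_smooth ac.
have line w (v t : R) : L (base u, vec u + v *: tvec c ab.1 w + t *: tvec c ab.1 z) ^+ 2 / 2
    = energy c (ab + v *: (0, w) + t *: (0, z)).
  have -> : ab + v *: (0, w) = (ab.1, v *: w + ab.2).
    by rewrite (surjective_pairing (ab + _)) /= scaler0 addr0 addrC.
  rewrite /energy TM_chart_inv_line //; last exact: sab.1.
  rewrite /= tvec_linear //; last exact: sab.1.
  by rewrite /base /vec uE [X in (_, X + _)]addrC.
have E0 (w : 'rV[R]_n * 'rV[R]_n) : ab + (0 : R) *: w = ab by rewrite scale0r addr0.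
have dE ab' : slit_coord c ab' -> differentiable (energy c) ab'.
  exact: smooth_on_differentiable.
have dDE ab' : slit_coord c ab' -> differentiable (fun cd => 'D_(0, z) (energy c) cd) ab'.
  by apply: smooth_on_differentiable; exact: smooth_on_derive.
(* The inner derivative can be computed in the chart only where the fibre coordinate is nonzero; for
   [s] near 0 it is. *)
have nss : \forall s \near (0 : R), slit_coord c (ab + s *: (0, y)).
  have cs : {for (0 : R), continuous (fun s : R => ab + s *: (0, y))}.
    by apply: continuousD; [exact: cst_continuous|exact: scalel_continuous].
  by apply: cs; rewrite E0; exact: near_slit_coord.
transitivity ((fun s : R => 'D_(0, z) (energy c) (ab + s *: (0, y)))^`()%classic 0).
  rewrite !derive1E; apply: near_eq_derive; near=> s.
  have ss : slit_coord c (ab + s *: (0, y)).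
    by near: s.
  rewrite derive1E; under eq_fun do rewrite line.
  have d0 : differentiable (energy c) (ab + s *: (0, y) + (0 : R) *: (0, z)).
    by rewrite scale0r addr0; exact: dE.
  by have [_ ->] := is_derive_line d0; rewrite scale0r addr0.
rewrite derive1E.
have d0 : differentiable (fun cd => 'D_(0, z) (energy c) cd) (ab + (0 : R) *: (0, y)).
  by rewrite E0; exact: dDE.
by have [_ ->] := is_derive_line d0; rewrite E0.
Unshelve. all: by end_near. Qed.

End Metric.

(** * Symmetry, bilinearity and smoothness of the metric *)

Section Metric.
Context {R : realType} {n : nat} (M : manifold R n).
Implicit Types (c d : chart R n M) (x : (M -> R) -> R) (a b y z : 'rV[R]_n) (u : slit M).
Implicit Types (ab xy : 'rV[R]_n * 'rV[R]_n).

Variable L : TM M -> R.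
Hypothesis sL : smoothTM (fun u : slit M => L (val u)).

Notation g := (finsler_metric L).

Lemma metric_sym u x x' : tangent smoothM (base u) x -> tangent smoothM (base u) x' ->
  g u x x' = g u x' x.
Proof.
have [c [ab [ac sab uE]]] := slit_chart u; rewrite /base uE => tx tx'.
have [y ->] := tangent_tvec ac sab.1 tx; have [y' ->] := tangent_tvec ac sab.1 tx'.
rewrite !(metric_chart sL _ _ ac sab uE).
exact: derive_comm (open_slit_coord ac) (energy_smooth sL ac) sab.
Qed.

Lemma metric_linear_l u k x x' (z : (M -> R) -> R) : tangent smoothM (base u) x ->
  tangent smoothM (base u) x' -> tangent smoothM (base u) z ->
  g u (k *: x + x') z = k * g u x z + g u x' z.
Proof.
have [c [ab [ac sab uE]]] := slit_chart u; rewrite /base uE => tx tx' tz.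
have [y ->] := tangent_tvec ac sab.1 tx; have [y' ->] := tangent_tvec ac sab.1 tx'.
have [w ->] := tangent_tvec ac sab.1 tz.
rewrite -tvec_linear //; last exact: sab.1.
rewrite !(metric_chart sL _ _ ac sab uE).
have dE : differentiable (fun cd => 'D_(0, w) (energy L c) cd) ab.
  by apply: smooth_on_differentiable sab; apply: smooth_on_derive; exact: energy_smooth.
rewrite !(deriveE _ dE).
rewrite (_ : (0, k *: y + y') = k *: ((0, y) : 'rV[R]_n * 'rV[R]_n) + (0, y')).
  by rewrite linearD linearZ.
by congr (_, _); rewrite /= scaler0 addr0.
Qed.

Lemma metric_chart_sum c ab u y z : atlas c -> slit_coord c ab -> val u = TM_chart_inv c ab ->
  g u (tvec c ab.1 y) (tvec c ab.1 z) = \sum_i \sum_j (y ord0 i * z ord0 j) *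
    g u (tvec c ab.1 (delta_mx ord0 i)) (tvec c ab.1 (delta_mx ord0 j)).
Proof.
move=> ac sab uE.
have tt w : tangent smoothM (base u) (tvec c ab.1 w) by exact: tvec_tangentE uE.
have g0l w : tangent smoothM (base u) w -> g u 0 w = 0.
  move=> tw; have := metric_linear_l 1 (tangent_zero _ _) (tangent_zero _ _) tw.
  rewrite scaler0 addr0 mul1r => /eqP.
  by rewrite -subr_eq0 opprD addrA subrr sub0r oppr_eq0 => /eqP.
have suml w : tangent smoothM (base u) w -> forall y, g u (tvec c ab.1 y) w =
    \sum_i y ord0 i * g u (tvec c ab.1 (delta_mx ord0 i)) w.
  move=> tw y0; pose G := fun y => g u (tvec c ab.1 y) w.
  have lG : linear (G : 'rV[R]_n -> R).
    move=> k v v'; rewrite /G tvec_linear; [|exact: ac|exact: sab.1].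
    by rewrite metric_linear_l.
  pose LM := GRing.isLinear.Build _ _ _ _ _ lG.
  pose GL : {linear 'rV[R]_n -> R} := HB.pack G LM.
  rewrite -[LHS]/(GL y0) {1}(row_sum_coordL y0) linear_sum; apply: eq_bigr => i _.
  by rewrite linearZ.
rewrite suml //; apply: eq_bigr => i _; rewrite metric_sym // suml // mulr_sumr.
by apply: eq_bigr => j _; rewrite mulrA metric_sym.
Qed.

(** Near a point the components of both fields are their values on the functions of
    [chart_coordinates], hence smooth, and the matrix of the metric consists of second fibre
    derivatives of the energy. *)
Lemma metric_smooth Y Z : pi_field Y -> pi_field Z ->
  smoothTM (fun q : slit M => g q (Y q) (Z q)).
Proof.
move=> [tY sY] [tZ sZ] c ac; apply: smooth_on_local => ab0 sab0.
have [U [xi [oU U0 Uc sxi xiE]]] := chart_coordinates ac sab0.1.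
pose A : set ('rV[R]_n * 'rV[R]_n) := slit_coord c `&` (fst @^-1` U).
have oA : open A.
  apply: openI; first exact: open_slit_coord.
  by apply: open_comp => // x _; exact: fst_continuous.
pose coef (F : slit M -> R) := extend0 F \o TM_chart_inv c.
exists A, (fun ab => \sum_i \sum_j
  (coef (fun q => Y q (xi i)) ab * coef (fun q => Z q (xi j)) ab) *
   'D_(0, delta_mx ord0 i) (fun cd => 'D_(0, delta_mx ord0 j) (energy L c) cd) ab).
split => //.
- have sc F : smoothTM F -> smooth_on A (coef F).
    by move=> sF; apply: smooth_onW (sF c ac) => ab [].
  apply: smooth_on_sum => // i; apply: smooth_on_sum => // j.
  apply: smooth_onM => //.
    by apply: smooth_onM => //; apply: sc; [exact: sY|exact: sZ].
  do 2 apply: smooth_on_derive; apply: smooth_onW (energy_smooth sL ac).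
  by move=> ab [].
- move=> ab [sab Uab]; have [u uE] := slitP ac sab.
  rewrite /coef /= -uE.
  have bu : base u = chart_inv c ab.1 by rewrite /base uE.
  have := tY u; rewrite bu => /(tangent_tvec ac sab.1) [y yE].
  have := tZ u; rewrite bu => /(tangent_tvec ac sab.1) [z zE].
  rewrite extend0_val yE zE (metric_chart_sum _ _ ac sab uE).
  apply: eq_bigr => i _; apply: eq_bigr => j _.
  have -> : extend0 (fun q => Y q (xi i)) (val u) = y ord0 i.
    by rewrite extend0_val yE; exact: xiE.
  have -> : extend0 (fun q => Z q (xi j)) (val u) = z ord0 j.
    by rewrite extend0_val zE; exact: xiE.
  by rewrite (metric_chart sL _ _ ac sab uE).
Qed.

End Metric.

(** * The conformal factor and its derivatives *)

Section Exponential.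
Context {R : realType} {n : nat} (M : manifold R n).

Lemma smooth_on_expR : smooth_on [set: R] expR.
Proof.
pose F := [set f : R -> R | exists k, f = fun x => k * expR x].
have : F expR by exists 1; apply/funext => t; rewrite mul1r.
apply: (smooth_on_realP openT) => [_ [k ->]|_ k [l ->]]; last first.
  by exists (k * l); apply/funext => t; rewrite mulrA.
exists (fun x => k * expR x); first by exists k.
by move=> t _; exact: (is_deriveZ k (is_derive_expR t)).
Qed.

Lemma derive_expR_comp (V : normedModType R) (h : V -> R) (a v : V) :
  differentiable h a -> 'D_v (fun x => expR (h x)) a = expR (h a) * 'D_v h a.
Proof.
move=> dh; have a0 : a + (0 : R) *: v = a by rewrite scale0r addr0.
have dh0 : differentiable h (a + (0 : R) *: v) by rewrite a0.
have de : differentiable (fun x => expR (h x)) (a + (0 : R) *: v).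
  apply: (differentiable_comp (g := expR)) => //.
  by apply/derivable1_diffP; exact: derivable_expR.
have [_ E1] := is_derive_line de; rewrite a0 in E1.
have [_ E2] := is_derive1_comp (f := expR) (is_derive_expR _) (is_derive_line dh0).
by rewrite a0 in E2; rewrite -E1 -E2.
Qed.

Lemma expR_smoothM (sigma : M -> R) : smoothM sigma -> smoothM (fun m => expR (2 * sigma m)).
Proof.
move=> ss c ac; apply: (smooth_on_comp_real (open_chart_cod ac)
  (f := fun a => 2 * sigma (chart_inv c a)) _ _ smooth_on_expR) => //.
by apply: smooth_on_scale; [exact: open_chart_cod|exact: ss].
Qed.

(** A chain rule for an abstract derivation. The function is pulled back from the manifold, so [w]
    may be replaced by its projection, which is a directional derivative in a chart. *)
Lemma tangent_expR (u : slit M) w (sigma : M -> R) : smoothM sigma -> tangent smoothTM u w ->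
  w (fun q => expR (2 * sigma (base q))) =
    2 * expR (2 * sigma (base u)) * w (fun q => sigma (base q)).
Proof.
move=> ss tw; have se := expR_smoothM ss.
rewrite -(rhoE u w se) -(rhoE u w ss).
have [c [ab [y [ac sab uE ->]]]] := tangent_slit (rho_tangent tw).
rewrite !tvecE //.
have ds := smoothM_differentiable ac ss sab.1.
have bu : base u = chart_inv c ab.1 by rewrite /base uE.
have d2 : differentiable (fun a => 2 * sigma (chart_inv c a)) ab.1 by exact: differentiableZ.
rewrite -[LHS]/('D_y (fun a => expR (2 * sigma (chart_inv c a))) ab.1).
rewrite derive_expR_comp // bu.
have -> : 'D_y (fun a => 2 * sigma (chart_inv c a)) ab.1 = 2 * 'D_y (sigma \o chart_inv c) ab.1.
  by rewrite -[LHS]/('D_y (2 \*: (sigma \o chart_inv c)) ab.1) deriveZ //; exact: diff_derivable.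
by rewrite mulrA (mulrC (expR _)).
Qed.

End Exponential.

(** * Consequences of homogeneity and of definiteness *)

Section Finsler.
Context {R : realType} {n : nat} (M : manifold R n).
Implicit Types (c d : chart R n M) (x : (M -> R) -> R) (a b y z : 'rV[R]_n) (u : slit M).
Implicit Types (ab xy : 'rV[R]_n * 'rV[R]_n).

Variable L : TM M -> R.
Hypothesis finslerL : finsler L.

Notation g := (finsler_metric L).

Let sL := finsler_smooth finslerL.

Lemma energy_homogeneous c a b (l : R) : atlas c -> chart_cod c a -> 0 < l ->
  energy L c (a, l *: b) = l ^+ 2 * energy L c (a, b).
Proof.
move=> ac ca l0; rewrite /energy.
have -> : TM_chart_inv c (a, l *: b) = (chart_inv c a, l *: tvec c a b).
  have := tvec_linear ac l b 0 ca; rewrite tvec0 !addr0 => <-.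
  exact: erefl.
rewrite (finsler_homogeneous finslerL) //; last exact: tvec_tangent.
by rewrite exprMn mulrA.
Qed.

Lemma derive_energy_homogeneous c a b z (l : R) : atlas c -> slit_coord c (a, b) -> 0 < l ->
  'D_(0, z) (energy L c) (a, l *: b) = l * 'D_(0, z) (energy L c) (a, b).
Proof.
move=> ac sab l0; have lN0 : l != 0 by rewrite gt_eqF.
have slab : slit_coord c (a, l *: b).
  split; first exact: sab.1.
  by move=> /= /eqP; rewrite scaler_eq0 (negbTE lN0) /= => /eqP; exact: sab.2.
have dE ab' : slit_coord c ab' -> differentiable (energy L c) ab'.
  by apply: smooth_on_differentiable; exact: energy_smooth.
have E0 (v w : 'rV[R]_n * 'rV[R]_n) : v + (0 : R) *: w = v by rewrite scale0r addr0.
have dl : differentiable (energy L c) ((a, l *: b) + (0 : R) *: (0, l *: z)).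
  by rewrite E0; exact: dE.
have d1 : differentiable (energy L c) ((a, b) + (0 : R) *: (0, z)).
  by rewrite E0; exact: dE.
have [_ El] := is_derive_line dl; rewrite E0 in El.
have i1 := is_derive_line d1; rewrite E0 in i1.
have [_ E1] := is_deriveZ (l ^+ 2) i1.
apply: (mulfI lN0); rewrite mulrA -expr2.
transitivity ('D_(0, l *: z) (energy L c) (a, l *: b)).
  rewrite !(deriveE _ (dE _ slab)) -[RHS](congr1 _ (_ : l *: (0, z) = (0, l *: z))).
    by rewrite linearZ.
  by congr (_, _); rewrite /= scaler0.
rewrite -El -[RHS]E1; apply: (congr1 (fun f : R -> R => 'D_(1 : R) f (0 : R))); apply/funext => t.
rewrite -[RHS]/(l ^+ 2 * energy L c ((a, b) + t *: (0, z))).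
rewrite (surjective_pairing ((a, l *: b) + _)) (surjective_pairing ((a, b) + _)) /= !scaler0 !addr0.
rewrite scalerA (mulrC t l) -scalerA -scalerDr.
exact: (energy_homogeneous _ ac sab.1 l0).
Qed.

(** Euler's relation: the first fibre derivative of the energy is homogeneous of degree 1, so its
    derivative along the ray through the point returns its value. *)
Lemma metric_eta c ab z u : atlas c -> slit_coord c ab -> val u = TM_chart_inv c ab ->
  g u (vec u) (tvec c ab.1 z) = 'D_(0, z) (energy L c) ab.
Proof.
move=> ac sab uE; have sE := energy_smooth sL ac.
have -> : vec u = tvec c ab.1 ab.2 by rewrite /vec uE /tvec -surjective_pairing.
rewrite (metric_chart sL _ _ ac sab uE).
have E0 (v w : 'rV[R]_n * 'rV[R]_n) : v + (0 : R) *: w = v by rewrite scale0r addr0.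
have dDE : differentiable (fun cd => 'D_(0, z) (energy L c) cd) (ab + (0 : R) *: (0, ab.2)).
  by rewrite E0; apply: smooth_on_differentiable sab; exact: smooth_on_derive.
have [_ E] := is_derive_line dDE; rewrite E0 in E; rewrite -E.
have [D DE] : exists D : R, D = 'D_(0, z) (energy L c) ab.
  exact (ex_intro _ _ erefl).
rewrite -DE.
(* By homogeneity the value at the fibre coordinate scaled by 1 + t is (1 + t) D, as long as 1 + t
   is positive. *)
transitivity ('D_(1 : R) (fun t : R => D + D * t) (0 : R)).
  apply: near_eq_derive; near=> t.
  have t1 : 0 < 1 + t.
    rewrite -ltrBlDl sub0r; near: t; apply: lt_nbhsr; exact: ltrN10.
  rewrite (surjective_pairing (ab + _)) /= scaler0 addr0.
  have -> : ab.2 + t *: ab.2 = (1 + t) *: ab.2 by rewrite scalerDl scale1r.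
  have sab' : slit_coord c (ab.1, ab.2) by rewrite -surjective_pairing.
  rewrite (derive_energy_homogeneous z ac sab' t1) -surjective_pairing -DE.
  by rewrite mulrDl mul1r mulrC.
have i1 := is_deriveD (is_derive_cst D (0 : R) (1 : R))
  (is_deriveZ D (is_derive_id (0 : R) (1 : R))).
by have [_ i2] := i1; apply: etrans i2 _; rewrite add0r scaleRE mulr1.
Unshelve. all: by end_near. Qed.

(** This is how the vanishing of the contracted third derivative is used. By [metric_eta] the
    product of eta with [zeta] is a first fibre derivative of the energy, so one further fibre
    derivative gives the metric itself, and third derivatives never appear. *)
Lemma gamma_metric_eta u x (zeta : M -> (M -> R) -> R) :
  pi_field (fun q : slit M => zeta (base q)) -> tangent smoothM (base u) x ->
  gamma u x (fun q => g q (vec q) (zeta (base q))) = g u x (zeta (base u)).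
Proof.
move=> pz tx; have sF := metric_smooth sL (vec_pi_field M) pz.
have [c [ab [y [ac sab uE ->]]]] := tangent_slit tx.
rewrite (gamma_chart _ ac sab uE) chart_derivationE //.
have bu : base u = chart_inv c ab.1 by rewrite /base uE.
have := pz.1 u; rewrite bu => /(tangent_tvec ac sab.1) [z zE].
rewrite zE (metric_chart sL _ _ ac sab uE).
have E0 (v w : 'rV[R]_n * 'rV[R]_n) : v + (0 : R) *: w = v by rewrite scale0r addr0.
have dF := smoothTM_differentiable ac sab sF.
set F := extend0 _ \o _ in dF *.
have dF0 : differentiable F (ab + (0 : R) *: (0, y)) by rewrite E0.
have dD0 : differentiable (fun cd => 'D_(0, z) (energy L c) cd) (ab + (0 : R) *: (0, y)).
  rewrite E0; apply: smooth_on_differentiable sab; apply: smooth_on_derive.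
  exact: energy_smooth.
have [_ EF] := is_derive_line dF0; have [_ ED] := is_derive_line dD0.
rewrite !E0 in EF ED; rewrite -EF -ED.
have nss : \forall s \near (0 : R), slit_coord c (ab + s *: (0, y)).
  have cs : {for (0 : R), continuous (fun s : R => ab + s *: (0, y))}.
    by apply: continuousD; [exact: cst_continuous|exact: scalel_continuous].
  by apply: cs; rewrite E0; exact: near_slit_coord.
apply: near_eq_derive; near=> t.
have st : slit_coord c (ab + t *: (0, y)) by near: t.
have [v vE] := slitP ac st.
have e1 : (ab + t *: (0, y)).1 = ab.1 by rewrite /= scaler0 addr0.
have bv : base v = chart_inv c ab.1 by rewrite /base vE -e1.
by rewrite /F /= -vE extend0_val bv zE -{1}e1 (metric_eta z ac st vE).
Unshelve. all: by end_near. Qed.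

(** Definiteness makes the Gram matrix of a chart basis invertible. This provides the vectors behind
    the choices in [Pbar] and [Tprime]. *)
Lemma metric_riesz u (l : ((M -> R) -> R) -> R) :
  (forall k x x', tangent smoothM (base u) x -> tangent smoothM (base u) x' ->
     l (k *: x + x') = k * l x + l x') ->
  exists2 p, tangent smoothM (base u) p &
    forall x, tangent smoothM (base u) x -> g u p x = l x.
Proof.
have [c [ab [ac sab uE]]] := slit_chart u; move=> ll.
have tt w : tangent smoothM (base u) (tvec c ab.1 w) by exact: tvec_tangentE uE.
pose e i := tvec c ab.1 (delta_mx ord0 i).
pose G := \matrix_(i < n, j < n) g u (e i) (e j).
have gE y z : g u (tvec c ab.1 y) (tvec c ab.1 z) = (y *m G *m z^T) ord0 ord0.
  rewrite (metric_chart_sum sL _ _ ac sab uE) mxE exchange_big; apply: eq_bigr => j _.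
  by rewrite !mxE mulr_suml; apply: eq_bigr => i _; rewrite !mxE mulrAC.
have fG : row_free G.
  apply: inj_row_free => y yG; apply: contrapT => y0.
  have /(finsler_definite finslerL (tt y)) : tvec c ab.1 y <> 0.
    by rewrite -(tvec0 c ab.1) => /(tvec_inj ac sab.1).
  by rewrite gE yG mul0mx mxE ltxx.
have uG : G \in unitmx by rewrite -row_free_unit.
pose lr : 'rV[R]_n := \row_j l (e j).
exists (tvec c ab.1 (lr *m invmx G)); first exact: tt.
move=> x; rewrite /base uE => /(tangent_tvec ac sab.1) [y ->].
rewrite gE mulmxKV //.
have lG : linear (fun y => l (tvec c ab.1 y) : R).
  by move=> k v v'; rewrite tvec_linear ?ll //; exact: sab.1.
pose LM := GRing.isLinear.Build _ _ _ _ _ lG.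
pose GL : {linear 'rV[R]_n -> R} := HB.pack (fun y => l (tvec c ab.1 y)) LM.
rewrite -[RHS]/(GL y) {2}(row_sum_coordL y) linear_sum mxE; apply: eq_bigr => i _.
by rewrite linearZ !mxE mulrC.
Qed.

End Finsler.

(** * Connections *)

Section Connection.
Context {R : realType} {n : nat} (M : manifold R n).
Notation vecM := ((M -> R) -> R).
Notation vecTM := ((slit M -> R) -> R).
Implicit Types (x z : vecM) (u : slit M) (w : vecTM) (Y : slit M -> vecM).
Notation TxM u := (tangent smoothM (base u)).

Lemma pi_field_zero : pi_field (fun _ : slit M => (0 : vecM)).
Proof.
split=> [u|f _]; first exact: tangent_zero.
by have [Ck _ _] := smoothTM_subalgebra M; exact: Ck.
Qed.

Lemma rho_pi_field (X : slit M -> vecTM) : vector_field smoothTM X ->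
  pi_field (fun q => rho q (X q)).
Proof.
move=> [tX sX]; split=> [u|f sf]; first exact: rho_tangent.
rewrite (_ : (fun u => _) = fun q => X q (fun q' => f (base q'))).
  by apply: sX; exact: base_smooth.
by apply/funext => q; rewrite rhoE.
Qed.

(* The vertical Chern derivative; it involves no connection. *)
Definition fibre_derivative u x Y : vecM := fun f =>
  if `[< smoothM f >] then gamma u x (fun q => Y q f) else 0.

Lemma fibre_derivativeE u x Y f : smoothM f ->
  fibre_derivative u x Y f = gamma u x (fun q => Y q f).
Proof. by move=> sf; rewrite /fibre_derivative; case: asboolP. Qed.

Lemma fibre_derivative_out u x Y f : ~ smoothM f -> fibre_derivative u x Y f = 0.
Proof. by move=> sf; rewrite /fibre_derivative; case: asboolP. Qed.

(** The Leibniz rule at the base point survives because [gamma] kills the factors pulled back from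
    the manifold. *)
Lemma fibre_derivative_tangent u x Y : TxM u x -> pi_field Y ->
  TxM u (fibre_derivative u x Y).
Proof.
move=> tx [tY sY]; have [Ck CD CM] := smoothM_subalgebra M.
have CT := smoothTM_subalgebra M; have [CTk CTD CTM] := CT.
have tg := gamma_tangent tx.
split=> [f|k f h sf sh|f h sf sh]; first exact: fibre_derivative_out.
- rewrite !fibre_derivativeE //; last by apply: CD => //; exact: CM.
  rewrite (_ : (fun q => _) = fun q => k * Y q f + Y q h); last first.
    by apply/funext => q; have [_ -> //] := tY q.
  by have [_ + _] := tg; apply; exact: sY.
- rewrite !fibre_derivativeE //; last exact: CM.
  rewrite (_ : (fun q => _) = fun q => f (base q) * Y q h + h (base q) * Y q f); last first.
    by apply/funext => q; have [_ _ -> //] := tY q.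
  have bf := base_smooth sf; have bh := base_smooth sh.
  have sYf := sY f sf; have sYh := sY h sh.
  rewrite (tangent_add tg (CTM _ _ bf sYh) (CTM _ _ bh sYf)).
  rewrite (tangent_mul tg bf sYh) (tangent_mul tg bh sYf).
  by rewrite !gamma_base // !mulr0 !addr0.
Qed.

Lemma fibre_derivative_linear u k x x' Y : TxM u x -> TxM u x' ->
  fibre_derivative u (k *: x + x') Y =
  k *: fibre_derivative u x Y + fibre_derivative u x' Y.
Proof.
move=> tx tx'; apply/funext => f.
rewrite -[RHS]/(k * fibre_derivative u x Y f + fibre_derivative u x' Y f).
have [sf|sf] := pselect (smoothM f); last by rewrite !fibre_derivative_out // mulr0 addr0.
by rewrite !fibre_derivativeE // gamma_linear.
Qed.

Lemma fibre_derivative_base u x (zeta : M -> vecM) : TxM u x ->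
  (forall f, smoothM f -> smoothM (fun m => zeta m f)) ->
  fibre_derivative u x (fun q => zeta (base q)) = 0.
Proof.
move=> tx sz; apply/funext => f; rewrite -[RHS]/(0 : R).
have [sf|sf] := pselect (smoothM f); last by rewrite fibre_derivative_out.
by rewrite fibre_derivativeE // (gamma_base tx (sz f sf)).
Qed.

Lemma fibre_derivative_vec u x : TxM u x -> fibre_derivative u x vec = x.
Proof.
move=> tx; apply/funext => f.
have [sf|sf] := pselect (smoothM f); last first.
  by rewrite fibre_derivative_out // (tangent_out tx).
have sv := (vec_pi_field M).2 f sf.
rewrite fibre_derivativeE // /gamma; case: asboolP => // _.
have [c [ab [y [ac sab uE xE]]]] := tangent_slit tx.
transitivity ('D_(1 : R) (fun t : R => vec u f + x f * t) (0 : R)); last first.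
  have i1 := is_deriveD (is_derive_cst (vec u f) (0 : R) (1 : R))
    (is_deriveZ (x f) (is_derive_id (0 : R) (1 : R))).
  by have [_ i2] := i1; apply: etrans i2 _; rewrite add0r scaleRE mulr1.
rewrite derive1E; apply: near_eq_derive.
have nss : \forall s \near (0 : R), slit_coord c (ab + s *: (0, y)).
  have cs : {for (0 : R), continuous (fun s : R => ab + s *: (0, y))}.
    by apply: continuousD; [exact: cst_continuous|exact: scalel_continuous].
  by apply: cs; rewrite scale0r addr0; exact: near_slit_coord.
near=> t; have st : slit_coord c (ab + t *: (0, y)) by near: t.
have [v vE] := slitP ac st.
have bv : (base u, vec u + t *: x) = val v.
  by rewrite vE TM_chart_inv_line; [rewrite xE /base /vec uE|exact: ac|exact: sab.1].
by rewrite bv extend0_val /vec -bv -[LHS]/(vec u f + t * x f) mulrC.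
Unshelve. all: by end_near. Qed.

(** * Regular connections: horizontal lift, torsion and Chern derivative at a point *)

Section LinearConnection.
Variable D : covariant M.
Hypotheses (lD : linear_connection D) (rD : regular D).

Lemma connection_zero_field u w : tangent smoothTM u w -> D u w (fun=> 0) = 0.
Proof.
move=> tw; have := connection_additive lD tw pi_field_zero pi_field_zero.
rewrite (_ : (fun q : slit M => _) = (fun=> 0)); last by apply/funext => q; rewrite addr0.
by move=> /eqP; rewrite -subr_eq0 opprD addrA subrr sub0r oppr_eq0 => /eqP.
Qed.

Lemma Kmap_linear u k w w' : tangent smoothTM u w -> tangent smoothTM u w' ->
  Kmap D u (k *: w + w') = k *: Kmap D u w + Kmap D u w'.
Proof. by move=> tw tw'; apply: (connection_linear lD) => //; exact: vec_pi_field. Qed.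

Lemma Kmap_tangent u w : tangent smoothTM u w -> TxM u (Kmap D u w).
Proof. by move=> tw; apply: (connection_tangent lD) => //; exact: vec_pi_field. Qed.

Lemma horizontal_unique u w w' : horizontal D u w -> horizontal D u w' ->
  rho u w = rho u w' -> w = w'.
Proof.
move=> [tw Kw] [tw' Kw'] E; apply/eqP; rewrite -subr_eq0; apply/eqP.
have tB : tangent smoothTM u ((-1) *: w' + w) by exact: tangent_linear.
have [_ VH] := rD u; rewrite addrC -scaleN1r.
suff : (vertical u `&` horizontal D u) ((-1) *: w' + w) by rewrite VH.
split; split=> //; first by rewrite rho_linear E scaleN1r addNr.
by rewrite Kmap_linear // Kw Kw' scaler0 addr0.
Qed.

(** Dropping the vertical part of any lift of [x] does not change its projection, so a horizontal
    lift exists and the default value of [xget] does not occur. *)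
Lemma betaP u x : TxM u x -> horizontal D u (beta D u x) /\ rho u (beta D u x) = x.
Proof.
move=> tx; have [w tw wx] := rho_surjective tx.
have [/(_ w tw) [v [h [[tv rv] hh wE]]] _] := rD u.
apply: (@xgetPex _ 0 [set w | horizontal D u w /\ rho u w = x]).
exists h; split=> //; rewrite -wx wE -[v]scale1r rho_linear rv.
by rewrite scaler0 add0r.
Qed.

Lemma beta_tangent u x : TxM u x -> tangent smoothTM u (beta D u x).
Proof. by move=> /betaP [[]]. Qed.

Lemma Kmap_beta u x : TxM u x -> Kmap D u (beta D u x) = 0.
Proof. by move=> /betaP [[]]. Qed.

Lemma rho_beta u x : TxM u x -> rho u (beta D u x) = x.
Proof. by move=> /betaP []. Qed.

Lemma beta_unique u w : horizontal D u w -> beta D u (rho u w) = w.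
Proof.
move=> hw; have [hb rb] := betaP (rho_tangent hw.1).
exact: horizontal_unique hb hw rb.
Qed.

Lemma beta_linear u k x x' : TxM u x -> TxM u x' ->
  beta D u (k *: x + x') = k *: beta D u x + beta D u x'.
Proof.
move=> tx tx'; have tb := beta_tangent tx; have tb' := beta_tangent tx'.
have [hb rb] := betaP (tangent_linear k tx tx').
apply: (horizontal_unique hb).
  split; first exact: (tangent_linear k tb tb').
  by rewrite Kmap_linear // !Kmap_beta // scaler0 addr0.
by rewrite rb rho_linear !rho_beta.
Qed.

Lemma beta_base u x f : TxM u x -> smoothM f ->
  beta D u x (fun q => f (base q)) = x f.
Proof. by move=> tx sf; rewrite -(rhoE u _ sf) rho_beta. Qed.

Definition vertical_torsion u x Y : vecM := D u (gamma u x) Y - fibre_derivative u x Y.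

(** Since [rho] kills vertical lifts, one covariant derivative vanishes. The projected bracket acts
    on pulled back functions, where the horizontal lift of [Y] is [Y] itself and the vertical lift
    of [X] gives 0; what remains of it is the fibre derivative of [Y]. *)
Lemma hv_torsionE (X : slit M -> vecM) Y u : (forall q, TxM q (X q)) -> pi_field Y ->
  hv_torsion D X Y u = vertical_torsion u (X u) Y.
Proof.
move=> tX pY; rewrite /hv_torsion /torsion.
rewrite (_ : (fun q => rho q (beta D q (Y q))) = Y); last first.
  by apply/funext => q; rewrite rho_beta //; exact: pY.1.
rewrite (_ : (fun q => rho q (gamma q (X q))) = (fun=> 0)); last first.
  by apply/funext => q; rewrite rho_gamma.
rewrite connection_zero_field ?subr0; last by apply: beta_tangent; exact: pY.1.
congr (_ - _); apply/funext => f.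
have [sf|sf] := pselect (smoothM f); last by rewrite rho_out // fibre_derivative_out.
rewrite rhoE // fibre_derivativeE // /lie_bracket.
rewrite (_ : (fun q => beta D q (Y q) _) = fun q => Y q f); last first.
  by apply/funext => q; rewrite beta_base //; exact: pY.1.
rewrite (_ : (fun q => gamma q (X q) _) = fun=> 0); last first.
  by apply/funext => q; rewrite gamma_base.
have tb : tangent smoothTM u (beta D u (Y u)) by apply: beta_tangent; exact: pY.1.
by rewrite (tangent_cst (smoothTM_subalgebra M) tb) subr0.
Qed.

Lemma vertical_torsion_tangent u x Y : TxM u x -> pi_field Y ->
  TxM u (vertical_torsion u x Y).
Proof.
move=> tx pY; apply: tangentB; last exact: fibre_derivative_tangent.
by apply: (connection_tangent lD) => //; exact: gamma_tangent.
Qed.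

Lemma vertical_torsion_linear u k x x' Y : TxM u x -> TxM u x' -> pi_field Y ->
  vertical_torsion u (k *: x + x') Y =
  k *: vertical_torsion u x Y + vertical_torsion u x' Y.
Proof.
move=> tx tx' pY; rewrite /vertical_torsion gamma_linear // fibre_derivative_linear //.
rewrite (connection_linear lD) //; [|exact: gamma_tangent..].
by rewrite scalerBr opprD addrACA.
Qed.

Lemma vertical_torsion0 u Y : pi_field Y -> vertical_torsion u 0 Y = 0.
Proof.
move=> pY; have t0 : TxM u 0 by exact: tangent_zero.
have := vertical_torsion_linear (-1) t0 t0 pY.
by rewrite scaler0 addr0 scaleN1r addNr.
Qed.

(** The vanishing of Q evaluated on [f]: the projected bracket acts on the pullback of [f], on which
    the horizontal lifts act as [X] and [Y]. As a scalar identity it can be compared for two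
    connections. *)
Lemma Qtorsion_bracket (X Y : slit M -> vecM) u f : pi_field X -> pi_field Y -> smoothM f ->
  Qtorsion D X Y u = 0 ->
  D u (beta D u (X u)) Y f - D u (beta D u (Y u)) X f =
  beta D u (X u) (fun q => Y q f) - beta D u (Y u) (fun q => X q f).
Proof.
move=> pX pY sf; rewrite /Qtorsion /torsion.
rewrite (_ : (fun q => rho q (beta D q (Y q))) = Y); last first.
  by apply/funext => q; rewrite rho_beta //; exact: pY.1.
rewrite (_ : (fun q => rho q (beta D q (X q))) = X); last first.
  by apply/funext => q; rewrite rho_beta //; exact: pX.1.
move=> /subr0_eq /(congr1 (fun v : vecM => v f)).
rewrite -[LHS]/(D u (beta D u (X u)) Y f - D u (beta D u (Y u)) X f) => ->.
have bE (Z : slit M -> vecM) : pi_field Z ->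
    (fun q => beta D q (Z q) (fun q' => f (base q'))) = fun q => Z q f.
  by move=> pZ; apply/funext => q; rewrite beta_base //; exact: pZ.1.
by rewrite (rhoE _ _ sf) /lie_bracket bE // bE.
Qed.

Definition chern_derivative u w Y : vecM := D u w Y - vertical_torsion u (Kmap D u w) Y.

Lemma chernE (X : slit M -> vecTM) Y u : (forall q, tangent smoothTM q (X q)) -> pi_field Y ->
  chern D X Y u = chern_derivative u (X u) Y.
Proof.
move=> tX pY; rewrite /chern hv_torsionE // => q.
by apply: (connection_tangent lD) => //; exact: vec_pi_field.
Qed.

Lemma chern_derivativeD u w w' Y : tangent smoothTM u w -> tangent smoothTM u w' ->
  pi_field Y ->
  chern_derivative u (w + w') Y = chern_derivative u w Y + chern_derivative u w' Y.
Proof.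
move=> tw tw' pY; rewrite /chern_derivative -{1 2}[w]scale1r.
rewrite (connection_linear lD) // Kmap_linear // vertical_torsion_linear //.
- by rewrite !scale1r opprD addrACA.
- exact: Kmap_tangent.
- exact: Kmap_tangent.
Qed.

Lemma chern_derivative_beta u x Y : TxM u x -> pi_field Y ->
  chern_derivative u (beta D u x) Y = D u (beta D u x) Y.
Proof.
by move=> tx pY; rewrite /chern_derivative Kmap_beta // vertical_torsion0 // subr0.
Qed.

End LinearConnection.
End Connection.

(** * Conformal change *)

Section Arithmetic.
Context {R : realType}.

Lemma addr_twice_eq (a b : R) : b = a + (a + b) -> a = 0.
Proof. by lra. Qed.

(** Here e is the conformal factor, s is X.sigma and y is g(Y,Z). The indices 1 and 2 stand for the
    derivative of Y paired with Z and of Z paired with Y: a for the second connection along its own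
    horizontal lift, d for the first one, f for the fibre derivative along NX. The term t is
    g(T(NX,Y),Z), occurring twice by symmetry of T. *)
Lemma conformal_cancel (e s y a1 a2 d1 d2 t f1 f2 : R) : e != 0 ->
  e * (d1 + d2 - (t + f1 + (t + f2))) + y * (2 * e * s) = e * a1 + e * a2 ->
  a1 - d1 + f1 + (a2 - d2 + f2) = 2 * s * y - 2 * t.
Proof.
move=> e0 E; apply: (mulfI e0).
transitivity (e * a1 + e * a2 - e * (d1 + d2 - f1 - f2)); first by ring.
by rewrite -E; ring.
Qed.

(* Koszul's trick: s1, s2, s3 are the values of g(A(X,Y),Z), g(A(X,Z),Y) and
   g(A(Y,Z),X) for a symmetric A. *)
Lemma koszul (s1 s2 s3 x y z gyz gzx gxy tx ty tz : R) :
  s1 + s2 = 2 * x * gyz - 2 * tx -> s3 + s1 = 2 * y * gzx - 2 * ty ->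
  s2 + s3 = 2 * z * gxy - 2 * tz ->
  s1 = x * gyz + y * gzx - gxy * z - ty + tz - tx.
Proof. by lra. Qed.

Lemma addr_cancel_swap (V : zmodType) (a b v : V) : v + a = b + (a - b + v).
Proof. by rewrite addrA (addrC b) subrK addrC. Qed.

Lemma addr_cancel_sub (V : zmodType) (a b v : V) : a = b - v + (a - b + v).
Proof. by rewrite -addrA (addrC (a - b)) addKr addrC subrK. Qed.

End Arithmetic.

(** * The Cartan connection of one Finsler function *)

Section Cartan.
Context {R : realType} {n : nat} (M : manifold R n).
Notation vecM := ((M -> R) -> R).
Notation vecTM := ((slit M -> R) -> R).
Implicit Types (x z : vecM) (u : slit M) (w : vecTM) (Y : slit M -> vecM).
Notation TxM u := (tangent smoothM (base u)).

Section Metric.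
Variable L : TM M -> R.
Hypothesis finslerL : finsler L.
Notation g := (finsler_metric L).
Let sL := finsler_smooth finslerL.

Lemma metricD_l u x x' z : TxM u x -> TxM u x' -> TxM u z ->
  g u (x + x') z = g u x z + g u x' z.
Proof. by move=> tx tx' tz; rewrite -{1}[x]scale1r (metric_linear_l sL 1 tx tx' tz) mul1r. Qed.

Lemma metric0_l u z : TxM u z -> g u 0 z = 0.
Proof.
move=> tz; have t0 : TxM u 0 by exact: tangent_zero.
have := metric_linear_l sL (-1) t0 t0 tz.
by rewrite scaler0 addr0 mulN1r addNr.
Qed.

Lemma metricZ_l u k x z : TxM u x -> TxM u z -> g u (k *: x) z = k * g u x z.
Proof.
move=> tx tz; have t0 : TxM u 0 by exact: tangent_zero.
by rewrite -[k *: x]addr0 (metric_linear_l sL k tx t0 tz) (metric0_l tz) addr0.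
Qed.

Lemma metricN_l u x z : TxM u x -> TxM u z -> g u (- x) z = - g u x z.
Proof. by move=> tx tz; rewrite -scaleN1r (metricZ_l _ tx tz) mulN1r. Qed.

Lemma metricB_l u x x' z : TxM u x -> TxM u x' -> TxM u z ->
  g u (x - x') z = g u x z - g u x' z.
Proof.
by move=> tx tx' tz; rewrite (metricD_l tx (tangentN tx') tz) (metricN_l tx' tz).
Qed.

Lemma metric_inj u x x' : TxM u x -> TxM u x' ->
  (forall Z, pi_field Z -> g u x (Z u) = g u x' (Z u)) -> x = x'.
Proof.
move=> tx tx' E; apply: contrapT => ne.
have tB := tangentB tx tx'.
have [zeta [pz zB _]] := pi_field_extension tB.
have := finsler_definite finslerL tB.
rewrite (metricB_l tx tx' tB) -{2 3}zB (E _ pz) subrr ltxx => /(_ _) B.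
by suff : false; [|apply: B => /subr0_eq].
Qed.

Variable D : covariant M.
Hypothesis cD : cartan L D.
Let lD := cartan_linear cD.
Let rD := cartan_regular cD.

Lemma vertical_torsion_sym u x Y Z : TxM u x -> pi_field Y -> pi_field Z ->
  g u (vertical_torsion D u x Y) (Z u) = g u (vertical_torsion D u x Z) (Y u).
Proof.
move=> tx pY pZ; have [zeta [pz zx _]] := pi_field_extension tx.
have := cartan_T cD pz pY pZ u.
by rewrite !(hv_torsionE lD rD) ?zx //; exact: pz.1.
Qed.

Lemma connection_gamma u x Y :
  D u (gamma u x) Y = vertical_torsion D u x Y + fibre_derivative u x Y.
Proof. by rewrite /vertical_torsion subrK. Qed.

(** Let t be this torsion and extend it to [zeta], constant along the fibre. The derivative of
    g(zeta, eta) along the vertical lift of x is g(x,t) by homogeneity, and g(t,t) + g(t,t) + g(t,x)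
    by the metric condition and the symmetry of the torsion. Hence g(t,t) = 0, and definiteness
    gives t = 0. *)
Lemma vertical_torsion_vec u x : TxM u x -> vertical_torsion D u x vec = 0.
Proof.
move=> tx; have pv := vec_pi_field M.
have tt : TxM u (vertical_torsion D u x vec).
  exact: (vertical_torsion_tangent lD).
have [zeta [pz zt sz]] := pi_field_extension tt.
have tg := gamma_tangent tx.
have := cartan_metric cD tg pz pv.
rewrite (_ : (fun q => g q (zeta (base q)) (vec q)) =
    (fun q => g q (vec q) (zeta (base q)))); last first.
  apply/funext => q; exact: (metric_sym sL (pz.1 q) (slit_tangent q)).
rewrite (gamma_metric_eta finslerL pz tx) !connection_gamma.
rewrite fibre_derivative_vec // (fibre_derivative_base tx sz) addr0.
rewrite (vertical_torsion_sym tx pz pv) zt.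
rewrite (metric_sym sL tt (tangentD tt tx)) (metricD_l tt tx tt) => E.
apply: contrapT => ne; have := finsler_definite finslerL tt ne.
by rewrite (addr_twice_eq E) ltxx.
Qed.

Lemma Kmap_gamma u x : TxM u x -> Kmap D u (gamma u x) = x.
Proof.
by move=> tx; rewrite /Kmap connection_gamma vertical_torsion_vec // fibre_derivative_vec // add0r.
Qed.

(** As [Kmap] inverts the vertical lift, the correction term in the Chern connection is exactly the
    torsion part of the Cartan derivative. The right side is free of [D], so it is shared by both
    Chern connections. *)
Lemma chern_derivative_gamma u x Y : TxM u x ->
  chern_derivative D u (gamma u x) Y = fibre_derivative u x Y.
Proof.
by move=> tx; rewrite /chern_derivative Kmap_gamma // connection_gamma addrC addKr.
Qed.

Lemma tangent_split u w : tangent smoothTM u w ->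
  w = gamma u (Kmap D u w) + beta D u (rho u w).
Proof.
move=> tw; have tK := Kmap_tangent lD tw; have tg := gamma_tangent tK.
suff -> : beta D u (rho u w) = (-1) *: gamma u (Kmap D u w) + w.
  by rewrite scaleN1r addNKr.
have -> : rho u w = rho u ((-1) *: gamma u (Kmap D u w) + w).
  by rewrite rho_linear rho_gamma // scaler0 add0r.
apply: (beta_unique lD rD); split; first exact: tangent_linear.
by rewrite (Kmap_linear lD) // Kmap_gamma // scaleN1r addNr.
Qed.

End Metric.

(** * Two conformally related Finsler functions *)

Section Conformal.
Variables (L Lt : TM M -> R) (sigma : M -> R) (nabla nablat : covariant M).
Hypotheses (finslerL : finsler L) (finslerLt : finsler Lt)
  (smooth_sigma : smoothM sigma) (LLt : conformal L Lt sigma)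
  (cartanL : cartan L nabla) (cartanLt : cartan Lt nablat).
Notation g := (finsler_metric L).
Notation gt := (finsler_metric Lt).
Notation b := (beta nabla).
Notation bt := (beta nablat).
Notation N := (Nmap nabla nablat).
Notation T := (vertical_torsion nabla).
Let sL := finsler_smooth finslerL.
Let lD := cartan_linear cartanL.
Let rD := cartan_regular cartanL.
Let lDt := cartan_linear cartanLt.
Let rDt := cartan_regular cartanLt.

(** N measures how far the first horizontal lift is from being horizontal for the second
    connection. *)
Lemma NmapE u x : TxM u x -> N u x = Kmap nablat u (b u x).
Proof.
by move=> tx; rewrite /Nmap -/(Kmap nabla u (b u x)) (Kmap_beta rD tx) subr0.
Qed.

Lemma Nmap_tangent u x : TxM u x -> TxM u (N u x).
Proof.
by move=> tx; rewrite NmapE //; apply: (Kmap_tangent lDt); exact: (beta_tangent rD).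
Qed.

Lemma Nmap_linear u k x x' : TxM u x -> TxM u x' ->
  N u (k *: x + x') = k *: N u x + N u x'.
Proof.
move=> tx tx'; rewrite !NmapE //; last exact: tangent_linear.
rewrite (beta_linear lD rD k tx tx') (Kmap_linear lDt) //; exact: (beta_tangent rD).
Qed.

(** Subtracting the vertical lift of [N u x] keeps the projection and makes the vector horizontal
    for [nablat], because [Kmap nablat] inverts the vertical lift. Uniqueness of horizontal lifts
    concludes. *)
Lemma beta_conformal u x : TxM u x -> bt u x = b u x - gamma u (N u x).
Proof.
move=> tx; have tb := beta_tangent rD tx; have tg := gamma_tangent (Nmap_tangent tx).
have -> : b u x - gamma u (N u x) = (-1) *: gamma u (N u x) + b u x.
  by rewrite scaleN1r addrC.
have {1}-> : x = rho u ((-1) *: gamma u (N u x) + b u x).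
  rewrite rho_linear (rho_gamma (Nmap_tangent tx)) scaler0 add0r.
  by rewrite (rho_beta rD tx).
apply: (beta_unique lDt rDt); split; first exact: tangent_linear.
rewrite (Kmap_linear lDt _ tg tb) (Kmap_gamma finslerLt cartanLt (Nmap_tangent tx)).
by rewrite NmapE // scaleN1r addNr.
Qed.

Lemma beta_sigma u x : TxM u x -> b u x (sigma \o base) = x sigma.
Proof. by move=> tx; rewrite -[RHS](beta_base rD tx smooth_sigma). Qed.

(* The form A(X,Y) of the header. *)
Definition chern_diff (X Y : slit M -> vecM) u : vecM :=
  nablat u (bt u (X u)) Y - nabla u (b u (X u)) Y + fibre_derivative u (N u (X u)) Y.

Lemma chern_diff_tangent X Y u : pi_field X -> pi_field Y -> TxM u (chern_diff X Y u).
Proof.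
move=> pX pY; have tX := pX.1 u; apply: tangentD; [apply: tangentB|].
- by apply: (connection_tangent lDt) => //; exact: (beta_tangent rDt).
- by apply: (connection_tangent lD) => //; exact: (beta_tangent rD).
- by apply: fibre_derivative_tangent => //; exact: Nmap_tangent.
Qed.

(** The two identities from Q = 0 are subtracted. The horizontal lifts differ by a vertical lift of
    N, and the fibre derivatives left over are those added in [chern_diff]. *)
Lemma chern_diff_sym X Y u : pi_field X -> pi_field Y -> chern_diff X Y u = chern_diff Y X u.
Proof.
move=> pX pY; apply/funext => f; have tX := pX.1 u; have tY := pY.1 u.
have [sf|sf] := pselect (smoothM f); last first.
  by rewrite (tangent_out (chern_diff_tangent u pX pY)) //
    (tangent_out (chern_diff_tangent u pY pX)).
have E1 := Qtorsion_bracket rD pX pY sf (cartan_Q cartanL pX pY u).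
have E2 := Qtorsion_bracket rDt pX pY sf (cartan_Q cartanLt pX pY u).
have bE (Z : slit M -> vecM) F : TxM u (Z u) ->
    bt u (Z u) F = b u (Z u) F - gamma u (N u (Z u)) F.
  by move=> tZ; rewrite beta_conformal.
rewrite (bE X _ tX) (bE Y _ tY) in E2.
have CE (Z W : slit M -> vecM) : chern_diff Z W u f =
    nablat u (bt u (Z u)) W f - nabla u (b u (Z u)) W f
    + gamma u (N u (Z u)) (fun q => W q f).
  by rewrite -(fibre_derivativeE _ _ _ sf).
rewrite !CE; move: E1 E2.
move: (nablat u _ _ f) (nablat u _ _ f) (nabla u _ _ f) (nabla u _ _ f)
  (gamma u _ _) (gamma u _ _) (b u _ _) (b u _ _) => a1 a2 a3 a4 a5 a6 a7 a8.
by lra.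
Qed.

Lemma chern_diff_metric X Y Z u : pi_field X -> pi_field Y -> pi_field Z ->
  g u (chern_diff X Y u) (Z u) + g u (Y u) (chern_diff X Z u) =
  2 * X u sigma * g u (Y u) (Z u) - 2 * g u (T u (N u (X u)) Y) (Z u).
Proof.
move=> pX pY pZ; have tX := pX.1 u; have tY := pY.1 u; have tZ := pZ.1 u.
have tN := Nmap_tangent tX; have tb := beta_tangent rD tX.
have tbt := beta_tangent rDt tX; have tg := gamma_tangent tN.
have sg := metric_smooth sL pY pZ.
have e0 : expR (2 * sigma (base u)) != 0 by rewrite gt_eqF // expR_gt0.
have E1 := cartan_metric cartanL tb pY pZ.
have E2 := cartan_metric cartanL tg pY pZ.
have E3 := cartan_metric cartanLt tbt pY pZ.
rewrite (_ : (fun q => gt q (Y q) (Z q)) =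
    (fun q => expR (2 * sigma (base q)) * g q (Y q) (Z q))) in E3; last first.
  by apply/funext => q; exact: (LLt (pY.1 q) (pZ.1 q)).
have tDtY : TxM u (nablat u (bt u (X u)) Y) by exact: (connection_tangent lDt).
have tDtZ : TxM u (nablat u (bt u (X u)) Z) by exact: (connection_tangent lDt).
have tDY : TxM u (nabla u (b u (X u)) Y) by exact: (connection_tangent lD).
have tDZ : TxM u (nabla u (b u (X u)) Z) by exact: (connection_tangent lD).
have tVY := fibre_derivative_tangent tN pY; have tVZ := fibre_derivative_tangent tN pZ.
have tTY := vertical_torsion_tangent lD tN pY.
have tTZ := vertical_torsion_tangent lD tN pZ.
(* The second metric condition is turned into one on [g]: the Leibniz rule on the conformal factor
   produces the term in sigma. *)
rewrite (tangent_mul tbt (base_smooth (expR_smoothM smooth_sigma)) sg) in E3.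
rewrite (tangent_expR smooth_sigma tbt) (LLt tDtY tZ) (LLt tY tDtZ) in E3.
rewrite (beta_base rDt tX smooth_sigma) in E3.
have bE F : bt u (X u) F = b u (X u) F - gamma u (N u (X u)) F by rewrite beta_conformal.
(* Along the second horizontal lift the derivative of g(Y,Z) is its derivative along the first lift
   minus a vertical one, and the latter splits into torsion and fibre derivative. *)
rewrite bE E1 E2 !connection_gamma in E3.
rewrite (metricD_l finslerL tTY tVY tZ) in E3.
rewrite (metric_sym sL tY (tangentD tTZ tVZ)) (metricD_l finslerL tTZ tVZ tY) in E3.
rewrite -(vertical_torsion_sym cartanL tN pY pZ) in E3.
rewrite (metricD_l finslerL (tangentB tDtY tDY) tVY tZ) (metricB_l finslerL tDtY tDY tZ).
have tCZ := chern_diff_tangent u pX pZ.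
rewrite (metric_sym sL tY tCZ).
rewrite (metricD_l finslerL (tangentB tDtZ tDZ) tVZ tY) (metricB_l finslerL tDtZ tDZ tY).
rewrite (metric_sym sL tY tDZ) (metric_sym sL tY tDtZ) in E3.

exact: (conformal_cancel e0 E3).
Qed.

(** Since sigma is a function on the base, the horizontal part of a vector and its projection
    differentiate it alike. The condition on [Pbar] thus prescribes a linear form on the fibre,
    which [metric_riesz] represents. *)
Lemma PbarP u : TxM u (Pbar L sigma nabla u) /\
  forall x, TxM u x -> g u (Pbar L sigma nabla u) x = x sigma.
Proof.
set A := [set p | TxM u p /\ forall w, tangent smoothTM u w ->
  g u p (rho u w) = hproj nabla u w (sigma \o base)].
have hE w : tangent smoothTM u w -> hproj nabla u w (sigma \o base) = rho u w sigma.
  by move=> tw; rewrite /hproj; apply: beta_sigma; exact: rho_tangent.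
have [p tp pE] := metric_riesz finslerL (l := fun x => x sigma)
  (fun k x x' (_ : TxM u x) (_ : TxM u x') => erefl).
have [tP PE] : A (Pbar L sigma nabla u).
  apply: (@xgetPex _ 0 A); exists p; split; first exact: tp.
  by move=> w tw; rewrite (hE _ tw); exact: pE (rho_tangent tw).
split; first exact: tP.
move=> x tx; have tb := beta_tangent rD tx.
by rewrite -(rho_beta rD tx) (PE _ tb) (hE _ tb).
Qed.

Lemma hv_torsion_Nmap Y Z u : pi_field Y -> pi_field Z ->
  hv_torsion nabla (fun q => N q (Z q)) Y u = T u (N u (Z u)) Y.
Proof.
move=> pY pZ; apply: (hv_torsionE lD rD (X := fun q => N q (Z q))) => // q.
exact: Nmap_tangent (pZ.1 q).
Qed.

(** The right side depends on [Z] only through its value at [u], thanks to the pointwise form of the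
    torsion, and linearly so; [metric_riesz] represents it. *)
Lemma TprimeP (X : slit M -> vecTM) Y u : TxM u (rho u (X u)) -> pi_field Y ->
  TxM u (Tprime L nabla nablat X Y u) /\ forall Z, pi_field Z ->
    g u (Tprime L nabla nablat X Y u) (Z u) = g u (T u (N u (Z u)) Y) (rho u (X u)).
Proof.
move=> tX pY; set A := [set t | TxM u t /\ forall Z, pi_field Z -> g u t (Z u) =
   g u (hv_torsion nabla (fun q => N q (Z q)) Y u) (rho u (X u))].
have [|p tp pE] := metric_riesz finslerL (u := u)
    (l := fun z => g u (T u (N u z) Y) (rho u (X u))).
  move=> k x x' tx tx'; have tN := Nmap_tangent tx; have tN' := Nmap_tangent tx'.
  rewrite (Nmap_linear k tx tx') (vertical_torsion_linear lD k tN tN' pY).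
  have tT := vertical_torsion_tangent lD tN pY.
  have tT' := vertical_torsion_tangent lD tN' pY.
  exact: (metric_linear_l sL k tT tT' tX).
have [tT TE] : A (Tprime L nabla nablat X Y u).
  apply: (@xgetPex _ 0 A); exists p; split; first exact: tp.
  by move=> Z pZ; rewrite (hv_torsion_Nmap u pY pZ); exact: pE (pZ.1 u).
split; first exact: tT.
by move=> Z pZ; rewrite -(hv_torsion_Nmap u pY pZ); exact: TE.
Qed.

Lemma chern_diff_omegac (X : slit M -> vecTM) Y u :
  (forall q, tangent smoothTM q (X q)) -> pi_field (fun q => rho q (X q)) -> pi_field Y ->
  chern_diff (fun q => rho q (X q)) Y u = omegac L sigma nabla nablat X Y u.
Proof.
move=> tX pX pY; set X' := fun q => rho q (X q).
have tX' := pX.1 u; have tY := pY.1 u.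
have [tP PE] := PbarP u.
have [tT TE] := TprimeP tX' pY.
have tNY := Nmap_tangent tY; have tNX := Nmap_tangent tX'.
have tTY := vertical_torsion_tangent lD tNY pX.
have tTX := vertical_torsion_tangent lD tNX pY.
rewrite /omegac (hv_torsion_Nmap u pX pY) (hv_torsion_Nmap u pY pX).
rewrite /hproj (beta_sigma tX') (beta_sigma tY).
have t1 := tangentZ (rho u (X u) sigma) tY.
have t2 := tangentZ (Y u sigma) tX'.
have t3 := tangentZ (g u (rho u (X u)) (Y u)) tP.
have t12 := tangentD t1 t2; have t123 := tangentB t12 t3.
have t4 := tangentB t123 tTY; have t5 := tangentD t4 tT; have t6 := tangentB t5 tTX.
apply: (metric_inj finslerL (chern_diff_tangent u pX pY) t6) => Z pZ.
have tZ := pZ.1 u; have tNZ := Nmap_tangent tZ.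
rewrite (metricB_l finslerL t5 tTX tZ) (metricD_l finslerL t4 tT tZ).
rewrite (metricB_l finslerL t123 tTY tZ) (metricB_l finslerL t12 t3 tZ).
rewrite (metricD_l finslerL t1 t2 tZ) (metricZ_l finslerL _ tY tZ).
rewrite (metricZ_l finslerL _ tX' tZ) (metricZ_l finslerL _ tP tZ).
rewrite (PE _ tZ) (TE _ pZ).
(* The compatibility identity for the three cyclic permutations of the fields. In the last one N
   acts on the test field [Z]; moving [Z] out of that term is what T' does. *)
have eX := chern_diff_metric u pX pY pZ.
have eY := chern_diff_metric u pY pZ pX.
have eZ := chern_diff_metric u pZ pX pY.
rewrite (metric_sym sL tY (chern_diff_tangent u pX pZ)) in eX.
rewrite (metric_sym sL tZ (chern_diff_tangent u pY pX)) (chern_diff_sym u pY pX) in eY.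
rewrite (metric_sym sL tX' (chern_diff_tangent u pZ pY)) (chern_diff_sym u pZ pY) in eZ.
rewrite (chern_diff_sym u pZ pX) in eZ.
rewrite (metric_sym sL tZ tX') (vertical_torsion_sym cartanL tNY pZ pX) in eY.
rewrite (vertical_torsion_sym cartanL tNZ pX pY) in eZ.
exact: (koszul eX eY eZ).
Qed.

(** The vector is split into a vertical lift and the first horizontal lift of its projection. The
    vertical parts agree; the first horizontal lift is the second one plus the vertical lift of N,
    which accounts for the fibre derivative in [chern_diff]. *)
Lemma chern_derivative_conformal (X : slit M -> vecTM) Y u : tangent smoothTM u (X u) ->
  pi_field Y ->
  chern_derivative nablat u (X u) Y =
  chern_derivative nabla u (X u) Y + chern_diff (fun q => rho q (X q)) Y u.
Proof.
move=> tX pY; have tx := rho_tangent tX; have tK := Kmap_tangent lD tX.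
have tN := Nmap_tangent tx; have tb := beta_tangent rD tx; have tbt := beta_tangent rDt tx.
have tgK := gamma_tangent tK; have tgN := gamma_tangent tN.
have bE : b u (rho u (X u)) = gamma u (N u (rho u (X u))) + bt u (rho u (X u)).
  by rewrite (beta_conformal tx) addrC subrK.
rewrite (tangent_split finslerL cartanL tX).
rewrite (chern_derivativeD lD tgK tb pY) (chern_derivativeD lDt tgK tb pY).
rewrite (chern_derivative_gamma finslerL cartanL _ tK).
rewrite (chern_derivative_gamma finslerLt cartanLt _ tK).
rewrite (chern_derivative_beta lD rD tx pY) -addrA; congr (_ + _).
rewrite {1}bE (chern_derivativeD lDt tgN tbt pY).
rewrite (chern_derivative_gamma finslerLt cartanLt _ tN).
rewrite (chern_derivative_beta lDt rDt tx pY) /chern_diff.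
exact: addr_cancel_swap.
Qed.

End Conformal.
End Cartan.

(** * The relation between the two Chern connections *)

Theorem theorem2p7 (R : realType) (n : nat) (M : manifold R n)
    (L Lt : TM M -> R) (sigma : M -> R) (nabla nablat : covariant M)
    (finslerL : finsler L) (finslerLt : finsler Lt)
    (smooth_sigma : smoothM sigma) (sigma_gt0 : forall x, 0 < sigma x)
    (LLt : conformal L Lt sigma)
    (cartanL : cartan L nabla) (cartanLt : cartan Lt nablat) :
  (forall X Y, vector_field smoothTM X -> pi_field Y -> forall u,
     chern nablat X Y u =
       chern nabla X Y u + omegac L sigma nabla nablat X Y u) /\
  (forall X Y, pi_field X -> pi_field Y -> forall u,
     chern nablat (fun q => gamma q (X q)) Y u =
       chern nabla (fun q => gamma q (X q)) Y u) /\
  (forall X Y, pi_field X -> pi_field Y -> forall u,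
     chern nablat (fun q => beta nablat q (X q)) Y u =
       chern nabla (fun q => beta nabla q (X q)) Y u
       - chern nabla (fun q => gamma q (Nmap nabla nablat q (X q))) Y u
       + Bc L sigma nabla nablat X Y u).
Proof.
have [lD rD] := (cartan_linear cartanL, cartan_regular cartanL).
have [lDt rDt] := (cartan_linear cartanLt, cartan_regular cartanLt).
split; [|split] => X Y pX pY u.
- rewrite !chernE //; [|exact: pX.1..].
  rewrite (chern_derivative_conformal finslerL finslerLt cartanL cartanLt (pX.1 u) pY).
  have E := chern_diff_omegac finslerL finslerLt smooth_sigma LLt cartanL cartanLt u pX.1
    (rho_pi_field pX) pY.
  by rewrite E.
- have tg q : tangent smoothTM q (gamma q (X q)) by apply: gamma_tangent; exact: pX.1.
  rewrite (chernE lD rD u tg pY) (chernE lDt rDt u tg pY).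
  rewrite (chern_derivative_gamma finslerL cartanL _ (pX.1 u)).
  exact: (chern_derivative_gamma finslerLt cartanLt _ (pX.1 u)).
- have tX q := pX.1 q; have tb q := beta_tangent rD (tX q).
  have tbt q := beta_tangent rDt (tX q).
  have tN q := Nmap_tangent cartanL cartanLt (tX q); have tg q := gamma_tangent (tN q).
  have rb : (fun q => rho q (beta nabla q (X q))) = X.
    by apply/funext => q; exact: rho_beta.
  rewrite (chernE lD rD u tb pY) (chernE lDt rDt u tbt pY) (chernE lD rD u tg pY).
  rewrite (chern_derivative_gamma finslerL cartanL _ (tN u)).
  rewrite (chern_derivative_beta lD rD (tX u) pY) (chern_derivative_beta lDt rDt (tX u) pY).
  rewrite /Bc.
  (* Since the projection of the horizontal lift of [X] is [X], the form [Bc] equals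
     [chern_diff X Y], and the claim becomes a rearrangement of its definition. *)
  rewrite -(chern_diff_omegac finslerL finslerLt smooth_sigma LLt cartanL cartanLt u tb) ?rb //.
  exact: addr_cancel_sub.
Qed.
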